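(* Let $m\ge 2$ and $1\le n\le m$ be integers. Let $\rho$ be a density operator on $\mathcal{H}_A\otimes\mathcal{H}_{B_1}\otimes\cdots\otimes\mathcal{H}_{B_n}$ (finite-dimensional, $\dim\mathcal{H}_A=d$). Let $M_1,\dots,M_m$ be observables on $\mathcal{H}_A$ with orthonormal eigenbases $\{|\psi^i_k\rangle\}_{k=1}^d$. Let $\mathbf{S}_1,\dots,\mathbf{S}_n$ be nonempty, pairwise disjoint subsets of $\{M_1,\dots,M_m\}$ whose union is $\{M_1,\dots,M_m\}$, and $m_t=|\mathbf{S}_t|$. Then $$\sum_{t=1}^n\sum_{M_i\in\mathbf{S}_t}S(M_i|B_t)\geqslant-\frac{1}{m-1}\log_2\Big(\prod_{1\le i<j\le m}c_{ij}\Big)+\frac{1}{m-1}\sum_{t=1}^n\frac{m_t(m_t-1)}{2}S(A|B_t)+\max\{0,\delta_{mn}\},$$ where $$\delta_{mn}=\frac{m(m-1)-\sum_{t=1}^n m_t(m_t-1)}{2(m-1)}S(A)+\sum_{t=1}^n\frac{m_t(m_t-1)}{2(m-1)}\mathcal{I}(A:B_t)-\sum_{t=1}^n\sum_{M_i\in\mathbf{S}_t}\mathcal{I}(M_i:B_t).$$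
   Context: All logarithms are base 2. $S(\sigma)=-\mathrm{Tr}\,\sigma\log_2\sigma$; $\rho^X$ is the reduced state of $\rho$ on subsystem(s) $X$, and $S(A)=S(\rho^A)$. $c_{ij}=\max_{k,l}|\langle\psi^i_k|\psi^j_l\rangle|^2$. $S(A|B_t)=S(\rho^{AB_t})-S(\rho^{B_t})$. $\mathcal{I}(A:B_t)=S(\rho^A)+S(\rho^{B_t})-S(\rho^{AB_t})$ is the mutual information. Post-measurement state: $\rho^{M_iB_t}=\sum_k(|\psi^i_k\rangle\langle\psi^i_k|\otimes\mathbb{I})\rho^{AB_t}(|\psi^i_k\rangle\langle\psi^i_k|\otimes\mathbb{I})$, with reduced state $\rho^{M_i}$ on $A$. $S(M_i|B_t)=S(\rho^{M_iB_t})-S(\rho^{B_t})$, and the Holevo quantity is $\mathcal{I}(M_i:B_t)=S(\rho^{M_i})+S(\rho^{B_t})-S(\rho^{M_iB_t})$. *)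

(* Defs.v *)
From HB Require Import structures.
From mathcomp Require Import all_boot all_order all_algebra.
From mathcomp Require Import complex.
From mathcomp Require Import reals exp.

Unset Printing Implicit Defensive.
Import Order.TTheory GRing.Theory Num.Theory.
Local Open Scope ring_scope.

Section QInfo.
Context {R : realType}.
Local Notation C := R[i].

(* Operators on C^T, T a finite index set (a finite-dim Hilbert space
   with its computational basis), as their matrix entries. *)
Definition q_op (T : finType) := T -> T -> C.

Definition q_trace {T : finType} (X : q_op T) : C := \sum_x X x x.

Definition q_psd {T : finType} (X : q_op T) : Prop :=
  forall v : T -> C, 0 <= \sum_x \sum_y (v x)^* * X x y * v y.

Definition q_density {T : finType} (X : q_op T) : Prop :=
  q_psd X /\ q_trace X = 1.

Definition q_hermitian {T : finType} (X : q_op T) : Prop :=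
  forall x y, X x y = (X y x)^*.

Definition q_inner {T : finType} (u v : T -> C) : C := \sum_x (u x)^* * v x.

Definition q_mx_of {T : finType} (X : q_op T) : 'M[C]_#|T| :=
  \matrix_(i, j) X (enum_val i) (enum_val j).

(* eigenvalues (with multiplicity) of X: roots of its characteristic
   polynomial, which splits over the algebraically closed field C *)
Definition q_eigs {T : finType} (X : q_op T) : seq C :=
  sval (closed_field_poly_normal (char_poly (q_mx_of X))).

Definition log2 (x : R) : R := ln x / ln 2.

Definition xlog2x (x : R) : R := if x == 0 then 0 else x * log2 x.

(* von Neumann q_entropy S(X) = - Tr X log2 X = - sum_lambda lambda log2 lambda *)
Definition q_entropy {T : finType} (X : q_op T) : R :=
  - \sum_(l <- q_eigs X) xlog2x (complex.Re l).

Definition Bsys (n : nat) (B : 'I_n -> finType) : finType :=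
  {dffun forall t : 'I_n, B t}.

Definition Jsys (d n : nat) (B : 'I_n -> finType) : finType :=
  ('I_d * Bsys n B)%type.

Definition q_upd {n : nat} {B : 'I_n -> finType} (g : Bsys n B) (t : 'I_n)
  (b : B t) : Bsys n B :=
  [ffun s => dfwith (fun s : 'I_n => g s) b s].

(* reduced state rho^{A B_t} : q_trace out all B_s, s <> t *)
Definition red_AB {d n : nat} {B : 'I_n -> finType} (rho : q_op (Jsys d n B))
  (t : 'I_n) : q_op ('I_d * B t)%type :=
  fun p q => \sum_(g : Bsys n B | g t == p.2) rho (p.1, g) (q.1, q_upd g t q.2).

Definition red_A {d n : nat} {B : 'I_n -> finType} (rho : q_op (Jsys d n B))
  : q_op 'I_d :=
  fun a a' => \sum_(g : Bsys n B) rho (a, g) (a', g).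

Definition ptrA {d : nat} {Y : finType} (X : q_op ('I_d * Y)%type) : q_op Y :=
  fun y y' => \sum_(a : 'I_d) X (a, y) (a, y').
Definition ptrB {d : nat} {Y : finType} (X : q_op ('I_d * Y)%type) : q_op 'I_d :=
  fun a a' => \sum_(y : Y) X (a, y) (a', y).

Definition red_B {d n : nat} {B : 'I_n -> finType} (rho : q_op (Jsys d n B))
  (t : 'I_n) : q_op (B t) := ptrA (red_AB rho t).

Definition q_proj {d : nat} (u : 'I_d -> C) : q_op 'I_d :=
  fun a a' => u a * (u a')^*.

(* post-measurement state sum_k (|psi_k><psi_k| (x) I) X (|psi_k><psi_k| (x) I) *)
Definition q_meas {d : nat} {Y : finType} (psi : 'I_d -> 'I_d -> C)
  (X : q_op ('I_d * Y)%type) : q_op ('I_d * Y)%type :=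
  fun p q => \sum_(k : 'I_d) \sum_(a1 : 'I_d) \sum_(a2 : 'I_d)
    q_proj (psi k) p.1 a1 * X (a1, p.2) (a2, q.2) * q_proj (psi k) a2 q.1.

(* q_orthonormal basis {psi_k}_k of C^d (psi k a = a-th coordinate) *)
Definition q_orthonormal {d : nat} (psi : 'I_d -> 'I_d -> C) : Prop :=
  forall k l, q_inner (psi k) (psi l) = (k == l)%:R.

Definition q_eigvec {d : nat} (X : q_op 'I_d) (u : 'I_d -> C) : Prop :=
  exists lam : C, forall a, \sum_b X a b * u b = lam * u a.

Definition q_normsq (z : C) : R := complex.Re z ^+ 2 + complex.Im z ^+ 2.

Definition cij {m d : nat} (psi : 'I_m -> 'I_d -> 'I_d -> C) (i j : 'I_m) : R :=
  \big[Num.max/0]_(k : 'I_d) \big[Num.max/0]_(l : 'I_d)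
     q_normsq (q_inner (psi i k) (psi j l)).

Definition condS_AB {d n : nat} {B : 'I_n -> finType} (rho : q_op (Jsys d n B))
  (t : 'I_n) : R :=
  q_entropy (red_AB rho t) - q_entropy (red_B rho t).

Definition condS_MB {d n : nat} {B : 'I_n -> finType} (rho : q_op (Jsys d n B))
  (psi : 'I_d -> 'I_d -> C) (t : 'I_n) : R :=
  q_entropy (q_meas psi (red_AB rho t)) - q_entropy (red_B rho t).

Definition mutinf_AB {d n : nat} {B : 'I_n -> finType} (rho : q_op (Jsys d n B))
  (t : 'I_n) : R :=
  q_entropy (red_A rho) + q_entropy (red_B rho t) - q_entropy (red_AB rho t).

Definition mutinf_MB {d n : nat} {B : 'I_n -> finType} (rho : q_op (Jsys d n B))
  (psi : 'I_d -> 'I_d -> C) (t : 'I_n) : R :=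
  q_entropy (ptrB (q_meas psi (red_AB rho t))) + q_entropy (red_B rho t)
  - q_entropy (q_meas psi (red_AB rho t)).

End QInfo.
Arguments q_op R T : clear implicits.
Arguments log2 {R} x.
Arguments xlog2x {R} x.

(* Main.v *)
Require Import Defs.
From HB Require Import structures.
From mathcomp Require Import all_boot all_order all_algebra.
From mathcomp Require Import complex sesquilinear spectral.
From mathcomp Require Import boolp functions.
From mathcomp Require Import reals topology normedtype derive realfun exp.
From mathcomp Require Import ring lra.
Set Implicit Arguments.
Unset Strict Implicit.
Import Order.TTheory GRing.Theory Num.Theory.
Import numFieldNormedType.Exports.
Local Open Scope complex_scope.
Local Open Scope ring_scope.

(** Summing a two-measurement bound over all pairs i < j counts every
measurement m - 1 times.  Pairs sharing a memory B_t use
S(X|B) + S(Z|B) >= - log c + S(A|B), pairs with different memories use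
S(X|B) + S(Z|C) >= - log c, and the [delta] alternative uses the first bound
with a trivial memory together with S(M|B) = S(M) - I(M:B).

The first bound reads D(rho_AB || Z rho_AB) >= sum_l D(rho_l || c rho_B), where
rho_l is the unnormalised state of B after outcome l of X.  For the second one,
purify by E: S(ZB) - S(AB) = S(Z|CE), which is at most S(Z|C).  Both are
comparisons of relative entropies, and they are obtained from the resolvents
sum_ij |<e_i|f_j>|^2 p_i^2 / (s p_i + q_j), whose integral over s > 0 is the
relative entropy up to normalisation and each of which is the maximum over K of
2 Re Tr(rho K) - s Tr(rho K K^* ) - Tr(sigma K^* K): it suffices to lift a test
operator K from the smaller system to the larger one. *)

(** * Logarithmic sums controlled by their resolvents *)

Section LogResolvent.
Context {R : realType}.

(* G(s) = sum_i u_i ln(s + x_i) is nondecreasing on s >= 0 and, as the u_i sum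
   to 0, it is O(1/s); hence G(0) <= 0. *)
Lemma resolvent_ln_le (I : finType) (u x : I -> R) :
  (forall i, 0 < x i) -> \sum_i u i = 0 ->
  (forall s : R, 0 < s -> 0 <= \sum_i u i / (s + x i)) ->
  \sum_i u i * ln (x i) <= 0.
Proof.
move=> x0 u0 us.
pose G (s : R) := \sum_i u i * ln (s + x i).
have dG (s : R) : 0 <= s -> is_derive s (1 : R) G (\sum_i u i / (s + x i)).
  move=> s0; rewrite /G.
  have -> : (fun s => \sum_i u i * ln (s + x i)) =
            \sum_i (fun s => u i * ln (s + x i)).
    by rewrite fct_sumE.
  elim/big_ind2 : _ => [|f1 d1 f2 d2 h1 h2|i _].
  - exact: is_derive_cst.
  - exact: is_deriveD.
  have sx : 0 < s + x i by rewrite ltr_wpDl.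
  have h1 : is_derive s (1 : R) (fun s : R => s + x i) 1.
    by apply: is_derive_eq; rewrite addr0.
  have h2 := is_derive1_ln sx.
  have h3 := @is_derive1_comp _ (@ln R) (fun s : R => s + x i) s _ _ h2 h1.
  apply: is_derive_eq.
  by rewrite mulr1.
have Gmono (s : R) : 0 < s -> G 0 <= G s.
  move=> s0; apply: (@ger0_derive1_ndecr _ G 0 s) => //; last exact: ltW.
  - by move=> y; rewrite in_itv /= => /andP[y0 _]; have [] := dG y (ltW y0).
  - move=> y; rewrite in_itv /= => /andP[y0 _]; rewrite derive1E.
    by have [_ ->] := dG y (ltW y0); exact: us.
  - apply: derivable_within_continuous => y; rewrite in_itv /= => /andP[y0 _].
    by have [] := dG y y0.
pose B := \sum_i `|u i| * x i.
have GB (s : R) : 0 < s -> G s <= B / s.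
  (* The weights sum to 0, so ln s can be subtracted from every logarithm; ln (1 + x_i / s) <= x_i /
     s then gives the decay. *)
  move=> s0; have -> : G s = \sum_i u i * ln (1 + x i / s).
    have -> : G s = G s - (\sum_i u i) * ln s by rewrite u0 mul0r subr0.
    rewrite mulr_suml -sumrB.
    apply: eq_bigr => i _; rewrite -mulrBr -ln_div ?posrE ?addr_gt0//.
    by rewrite mulrDl divff// gt_eqF.
  rewrite /B mulr_suml; apply: ler_sum => i _.
  have xs : 0 < x i / s by rewrite divr_gt0.
  have l0 : 0 <= ln (1 + x i / s) by rewrite ln_ge0// lerDl ltW.
  apply: (@le_trans _ _ (`|u i| * ln (1 + x i / s))).
    by apply: ler_wpM2r => //; exact: ler_norm.
  by rewrite -mulrA ler_wpM2l// le_ln1Dx// (lt_trans _ xs)// ltrN10.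
have -> : \sum_i u i * ln (x i) = G 0 by apply: eq_bigr => i _; rewrite add0r.
rewrite leNgt; apply/negP => G0.
have B0 : 0 <= B by apply: sumr_ge0 => i _; rewrite mulr_ge0// ltW.
(* At this s the decay bound B / s equals G(0) B / (B + 1), below G(0), which contradicts
   monotonicity. *)
have s0 : 0 < (B + 1) / G 0 by rewrite divr_gt0// ltr_wpDl.
have := le_trans (Gmono _ s0) (GB _ s0).
rewrite invf_div mulrA ler_pdivlMr ?ltr_wpDl// mulrC ler_pM2r// => h.
by move: h; rewrite gerDl ler10.
Qed.

(** The one-family statement on the disjoint union, with the weights of the second family
    negated. *)
Lemma resolvent_ln_le2 (I J : finType) (u x : I -> R) (v y : J -> R) :
  (forall i, 0 < x i) -> (forall j, 0 < y j) -> \sum_i u i = \sum_j v j ->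
  (forall s : R, 0 < s -> \sum_j v j / (s + y j) <= \sum_i u i / (s + x i)) ->
  \sum_i u i * ln (x i) <= \sum_j v j * ln (y j).
Proof.
move=> x0 y0 uv uvs.
pose w (k : I + J) := match k with inl i => u i | inr j => - v j end.
pose z (k : I + J) := match k with inl i => x i | inr j => y j end.
have := @resolvent_ln_le _ w z.
rewrite !big_sumType/= => H.
rewrite -subr_le0 -sumrN.
rewrite [X in _ + X](eq_bigr (fun j => - v j * ln (y j))) ?H//.
- by case.
- by rewrite sumrN uv subrr.
- move=> s s0; rewrite big_sumType/=.
  rewrite [X in _ + X](eq_bigr (fun j => - (v j / (s + y j)))).
    by rewrite sumrN subr_ge0 uvs.
  by move=> j _; rewrite mulNr.
- by move=> j _; rewrite mulNr.
Qed.

End LogResolvent.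

(** * Spectral decompositions and the variational form of the resolvent *)

Section Operators.
Context {R : realType}.
Local Notation C := R[i].
Implicit Types (T : finType) (z : C).

Lemma conj_real_complex (r : R) : (r%:C : C)^* = r%:C.
Proof. by apply: conj_Creal; rewrite complex_real. Qed.

Lemma mul_conj_normsq z : z * z^* = (q_normsq z)%:C.
Proof. by rewrite -normCK -add_Re2_Im2. Qed.

Lemma q_normsq_ge0 z : 0 <= q_normsq z.
Proof. by rewrite addr_ge0 ?sqr_ge0. Qed.

Lemma q_normsqM z w : q_normsq (z * w) = q_normsq z * q_normsq w.
Proof. by case: z w => [a b] [c d]; rewrite /q_normsq /=; ring. Qed.

Lemma q_normsq_real (r : R) : q_normsq r%:C = r ^+ 2.
Proof. by rewrite /q_normsq /= expr0n addr0. Qed.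

Lemma q_normsq_conj z : q_normsq z^* = q_normsq z.
Proof.
by apply: (@complexI R); rewrite -!mul_conj_normsq conjCK mulrC.
Qed.

Lemma Re_sum (I : Type) (r : seq I) (P : pred I) (F : I -> C) :
  complex.Re (\sum_(i <- r | P i) F i) = \sum_(i <- r | P i) complex.Re (F i).
Proof. by apply: (big_morph (@complex.Re R)) => // -[a b] [c d]. Qed.

Lemma Re_realM (r : R) z : complex.Re (r%:C * z) = r * complex.Re z.
Proof. by case: z => a b /=; rewrite mul0r subr0. Qed.

Lemma Re_real (r : R) : complex.Re (r%:C : C) = r. Proof. by []. Qed.

Definition q_form T (K : q_op R T) (u v : T -> C) : C :=
  \sum_x \sum_y (u x)^* * K x y * v y.
Definition q_mul T (K L : q_op R T) : q_op R T :=
  fun x y => \sum_z K x z * L z y.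
Definition q_adj T (K : q_op R T) : q_op R T := fun x y => (K y x)^*.
Definition q_tr2 T (X K : q_op R T) : C := \sum_x \sum_y X x y * K y x.
Definition q_onb T (e : T -> T -> C) : Prop :=
  forall i j, q_inner (e i) (e j) = (i == j)%:R.

Lemma sum_enum_val T (F : T -> C) : \sum_(i < #|T|) F (enum_val i) = \sum_x F x.
Proof. by rewrite -(big_enum_val (A := T) F). Qed.

Lemma q_innerC T (u v : T -> C) : q_inner u v = (q_inner v u)^*.
Proof.
rewrite /q_inner rmorph_sum; apply: eq_bigr => x _.
by rewrite rmorphM /= conjCK mulrC.
Qed.

(** With as many vectors as coordinates, orthonormality gives a one-sided inverse of a square
    matrix. It is then two-sided, and the other product is the resolution of the identity. *)
Lemma q_onb_complete T (e : T -> T -> C) : q_onb e ->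
  forall x y, \sum_i e i x * (e i y)^* = (x == y)%:R.
Proof.
move=> he x y.
pose A : 'M[C]_#|T| := \matrix_(i, j) (e (enum_val i) (enum_val j))^*.
pose B : 'M[C]_#|T| := \matrix_(i, j) e (enum_val j) (enum_val i).
have AB : A *m B = 1%:M.
  apply/matrixP => i j; rewrite !mxE.
  rewrite (eq_bigr (fun k : 'I_#|T| => (e (enum_val i) (enum_val k))^*
     * e (enum_val j) (enum_val k))); last by move=> k _; rewrite !mxE.
  rewrite (sum_enum_val (fun x => (e (enum_val i) x)^* * e (enum_val j) x)).
  by have := he (enum_val i) (enum_val j); rewrite /q_inner => ->;
     rewrite (inj_eq enum_val_inj).
have /matrixP/(_ (enum_rank x) (enum_rank y)) := mulmx1C AB.
rewrite !mxE.
rewrite (eq_bigr (fun k : 'I_#|T| => e (enum_val k) x * (e (enum_val k) y)^*));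
  last by move=> k _; rewrite !mxE !enum_rankK.
rewrite (sum_enum_val (fun k => e k x * (e k y)^*)) => ->.
by rewrite (inj_eq enum_rank_inj).
Qed.

Lemma sum_delta T (F : T -> C) x : \sum_y (x == y)%:R * F y = F x.
Proof.
rewrite (bigD1 x)//= eqxx mul1r big1 ?addr0// => y /negPf yx.
by rewrite eq_sym yx mul0r.
Qed.

Lemma q_onb_expand T (f : T -> T -> C) (v : T -> C) x : q_onb f ->
  v x = \sum_j f j x * q_inner (f j) v.
Proof.
move=> hf; rewrite -[LHS]sum_delta.
under eq_bigr => y _ do rewrite -(q_onb_complete hf) mulr_suml.
rewrite exchange_big /=; apply: eq_bigr => j _.
by rewrite mulr_sumr; apply: eq_bigr => y _; rewrite mulrA.
Qed.

Lemma q_form_expand T (f : T -> T -> C) (K : q_op R T) u v : q_onb f ->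
  q_form K u v = \sum_j q_form K u (f j) * q_inner (f j) v.
Proof.
move=> hf; rewrite /q_form.
under eq_bigr => x _ do under eq_bigr => y _ do
  rewrite (q_onb_expand v y hf) mulr_sumr.
under eq_bigr => x _ do rewrite exchange_big /=.
rewrite exchange_big /=; apply: eq_bigr => j _.
rewrite mulr_suml; apply: eq_bigr => x _.
by rewrite mulr_suml; apply: eq_bigr => y _; rewrite !mulrA.
Qed.

Lemma q_form_mul T (f : T -> T -> C) (K L : q_op R T) u v : q_onb f ->
  q_form (q_mul K L) u v = \sum_j q_form K u (f j) * q_form L (f j) v.
Proof.
move=> hf; pose w (t : T) := \sum_y L t y * v y.
transitivity (q_form K u w).
  rewrite /q_form; apply: eq_bigr => x _; rewrite /w /q_mul.
  under eq_bigr => y _ do rewrite mulr_sumr mulr_suml.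
  rewrite exchange_big /=; apply: eq_bigr => z _.
  by rewrite mulr_sumr; apply: eq_bigr => y _; rewrite !mulrA.
rewrite (q_form_expand _ _ _ hf); apply: eq_bigr => j _; congr (_ * _).
rewrite /q_inner /q_form; apply: eq_bigr => x _.
by rewrite /w mulr_sumr; apply: eq_bigr => y _; rewrite mulrA.
Qed.

Lemma q_form_adj T (K : q_op R T) u v : q_form (q_adj K) u v = (q_form K v u)^*.
Proof.
rewrite /q_form rmorph_sum exchange_big; apply: eq_bigr => x _ /=.
rewrite rmorph_sum; apply: eq_bigr => y _ /=.
by rewrite !rmorphM /= conjCK /q_adj; ring.
Qed.

(* A spectral decomposition with nonnegative eigenvalues.  The eigenvectors are
   indexed by T itself, so that there is always a full basis of them. *)
Record q_eigsys T := QEigSys {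
  ev : T -> R;
  evec : T -> T -> C;
  ev_ge0 : forall i, 0 <= ev i;
  evec_onb : q_onb evec }.

Definition q_ofeig T (E : q_eigsys T) : q_op R T :=
  fun x y => \sum_i (ev E i)%:C * (evec E i x * (evec E i y)^*).

Lemma q_tr2_eig T (E : q_eigsys T) (K : q_op R T) :
  q_tr2 (q_ofeig E) K = \sum_i (ev E i)%:C * q_form K (evec E i) (evec E i).
Proof.
rewrite /q_tr2 /q_ofeig /q_form.
under eq_bigr => x _ do under eq_bigr => y _ do rewrite mulr_suml.
under eq_bigr => x _ do rewrite exchange_big /=.
rewrite exchange_big /=; apply: eq_bigr => i _.
rewrite exchange_big mulr_sumr; apply: eq_bigr => y _ /=.
by rewrite mulr_sumr; apply: eq_bigr => x _; ring.
Qed.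

Lemma q_form_ofeig T (E : q_eigsys T) (u : T -> C) :
  q_form (q_ofeig E) u u =
  (\sum_i ev E i * q_normsq (q_inner u (evec E i)))%:C.
Proof.
rewrite rmorph_sum /q_form /q_ofeig.
under eq_bigr => x _ do under eq_bigr => y _ do rewrite mulr_sumr mulr_suml.
under eq_bigr => x _ do rewrite exchange_big /=.
rewrite exchange_big /=; apply: eq_bigr => i _.
rewrite rmorphM /= -mul_conj_normsq -q_innerC /q_inner big_distrl mulr_sumr.
apply: eq_bigr => x _ /=; rewrite !mulr_sumr; apply: eq_bigr => y _; ring.
Qed.

Lemma q_tr2_KKadj_ge0 T (E : q_eigsys T) (K : q_op R T) :
  0 <= complex.Re (q_tr2 (q_ofeig E) (q_mul (q_adj K) K)).
Proof.
rewrite q_tr2_eig Re_sum; apply: sumr_ge0 => i _.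
rewrite Re_realM mulr_ge0 ?ev_ge0//.
rewrite (q_form_mul _ _ _ _ (evec_onb E)) Re_sum; apply: sumr_ge0 => j _.
by rewrite q_form_adj mulrC mul_conj_normsq Re_real q_normsq_ge0.
Qed.

Definition q_J T (s : R) (rho sigma K : q_op R T) : R :=
  2 * complex.Re (q_tr2 rho K) - s * complex.Re (q_tr2 rho (q_mul K (q_adj K)))
  - complex.Re (q_tr2 sigma (q_mul (q_adj K) K)).

Definition q_overlap T (P Q : q_eigsys T) (i j : T) : R :=
  q_normsq (q_inner (evec Q j) (evec P i)).

Lemma q_overlap_suml T (P Q : q_eigsys T) i : \sum_j q_overlap P Q i j = 1.
Proof.
apply: (@complexI R); rewrite rmorph_sum /= rmorph1.
transitivity (q_inner (evec P i) (evec P i)); last by rewrite evec_onb eqxx.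
transitivity (\sum_j (q_inner (evec Q j) (evec P i)) *
   (q_inner (evec Q j) (evec P i))^*).
  by apply: eq_bigr => j _; rewrite mul_conj_normsq.
rewrite {3}/q_inner.
under [RHS]eq_bigr => x _ do rewrite {2}(q_onb_expand (evec P i) x (evec_onb Q)) mulr_sumr.
rewrite exchange_big; apply: eq_bigr => j _ /=.
rewrite -q_innerC {2}/q_inner mulr_sumr; apply: eq_bigr => x _; ring.
Qed.

(** Expanding K K^* through the eigenvectors f_j of sigma and K^* K through the eigenvectors e_i of
    rho makes everything depend on the single entries <e_i|K|f_j>, so that the maximisation splits
    into independent scalar problems. *)
Lemma q_J_eig T (P Q : q_eigsys T) (s : R) (K : q_op R T) :
  q_J s (q_ofeig P) (q_ofeig Q) K =
  \sum_i \sum_j (2 * (ev P i *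
      complex.Re (q_form K (evec P i) (evec Q j) *
                  q_inner (evec Q j) (evec P i)))
    - (s * ev P i + ev Q j) * q_normsq (q_form K (evec P i) (evec Q j))).
Proof.
under [RHS]eq_bigr => i _ do
  (under eq_bigr => j _ do rewrite [(s * _ + _) * _]mulrDl opprD addrA; rewrite !sumrB).
rewrite !sumrB /q_J; congr (_ - _ - _).
- rewrite q_tr2_eig Re_sum mulr_sumr; apply: eq_bigr => i _.
  rewrite Re_realM (q_form_expand _ _ _ (evec_onb Q)) Re_sum !mulr_sumr.
  by [].
- rewrite q_tr2_eig Re_sum mulr_sumr; apply: eq_bigr => i _.
  rewrite Re_realM (q_form_mul _ _ _ _ (evec_onb Q)) Re_sum !mulr_sumr.
  apply: eq_bigr => j _.
  by rewrite q_form_adj mul_conj_normsq Re_real mulrA.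
- rewrite exchange_big q_tr2_eig Re_sum /=; apply: eq_bigr => j _.
  rewrite Re_realM (q_form_mul _ _ _ _ (evec_onb P)) Re_sum !mulr_sumr.
  apply: eq_bigr => i _.
  by rewrite q_form_adj mulrC [X in complex.Re X]mulrC mul_conj_normsq Re_real mulrC.
Qed.

(** Completing the square entry by entry: with t = s p + q, k the entry of K and a the inner
    product, the gap multiplied by t is |t k - p a'|^2, where a' is the conjugate of a. *)
Lemma q_J_le T (P Q : q_eigsys T) (s : R) (K : q_op R T) : 0 < s ->
  q_J s (q_ofeig P) (q_ofeig Q) K <=
  \sum_i \sum_j q_overlap P Q i j * ev P i ^+ 2 / (s * ev P i + ev Q j).
Proof.
move=> s0; rewrite q_J_eig; apply: ler_sum => i _; apply: ler_sum => j _.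
rewrite /q_overlap.
set k := q_form _ _ _; set a := q_inner _ _.
have := ev_ge0 P i; have := ev_ge0 Q j.
(* For p = 0 the denominator may vanish; there the right side is 0 and the left side is - q
   |k|^2. *)
move: (ev P i) (ev Q j) => p q q0; rewrite le_eqVlt => /predU1P[<-|p0].
  rewrite expr0n /= !(mul0r, mulr0, add0r).
  by rewrite oppr_le0 mulr_ge0// q_normsq_ge0.
have t0 : 0 < s * p + q by rewrite ltr_wpDr// mulr_gt0.
move: (s * p + q) t0 => t t0.
rewrite ler_pdivlMr// -subr_ge0 /q_normsq.
case: k a => [k1 k2] [a1 a2] /=.
have -> : (a1 ^+ 2 + a2 ^+ 2) * p ^+ 2 -
   (2 * (p * (k1 * a1 - k2 * a2)) - t * (k1 ^+ 2 + k2 ^+ 2)) * t =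
   (t * k1 - p * a1) ^+ 2 + (t * k2 + p * a2) ^+ 2 by ring.
by rewrite addr_ge0 ?sqr_ge0.
Qed.

Lemma q_J_attained T (P Q : q_eigsys T) (s : R) : 0 < s ->
  exists K, q_J s (q_ofeig P) (q_ofeig Q) K =
  \sum_i \sum_j q_overlap P Q i j * ev P i ^+ 2 / (s * ev P i + ev Q j).
Proof.
move=> s0.
(* The zero of the completed square in each entry; [K] is the operator with these entries. *)
pose k i j : C := (ev P i / (s * ev P i + ev Q j))%:C *
   (q_inner (evec Q j) (evec P i))^*.
pose K : q_op R T := fun x y => \sum_i \sum_j k i j * (evec P i x * (evec Q j y)^*).
have Kk i j : q_form K (evec P i) (evec Q j) = k i j.
  rewrite /q_form /K.
  under eq_bigr => x _ do under eq_bigr => y _ do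
    (rewrite mulr_sumr mulr_suml; under eq_bigr => i' _ do
      rewrite mulr_sumr mulr_suml).
  under eq_bigr => x _ do rewrite exchange_big /=.
  rewrite exchange_big /=.
  under eq_bigr => i' _ do (under eq_bigr => x _ do rewrite exchange_big /=;
    rewrite exchange_big /=).
  transitivity (\sum_i' (i == i')%:R * \sum_j' (j == j')%:R * k i' j').
    apply: eq_bigr => i' _; rewrite mulr_sumr; apply: eq_bigr => j' _.
    rewrite -(evec_onb P i i') [j == j']eq_sym -(evec_onb Q j' j) /q_inner.
    rewrite mulr_suml; apply: eq_bigr => x _.
    rewrite mulr_suml mulr_sumr; apply: eq_bigr => y _; ring.
  by rewrite sum_delta sum_delta.
exists K; rewrite q_J_eig; apply: eq_bigr => i _; apply: eq_bigr => j _.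
rewrite Kk /k /q_overlap.
rewrite -mulrA [_^* * _]mulrC mul_conj_normsq Re_realM Re_real.
rewrite q_normsqM q_normsq_conj q_normsq_real.
have := ev_ge0 P i; have := ev_ge0 Q j.
move: (ev P i) (ev Q j) => p q q0; rewrite le_eqVlt => /predU1P[<-|p0].
  by rewrite expr0n /= !(mul0r, mulr0) expr0n /= !(mul0r, mulr0) subrr.
have t0 : 0 < s * p + q by rewrite ltr_wpDr// mulr_gt0.
by field; rewrite gt_eqF.
Qed.

(* Tr rho (ln rho - ln sigma).  As [ln 0 = 0], this is the relative entropy only
   when the support of rho lies in that of sigma, i.e. under [q_dominates]. *)
Definition q_relent T (P Q : q_eigsys T) : R :=
  \sum_i \sum_j q_overlap P Q i j * ev P i * (ln (ev P i) - ln (ev Q j)).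

Definition q_dominates T (Q P : q_eigsys T) : Prop :=
  forall i j, ev Q j = 0 -> q_overlap P Q i j * ev P i = 0.

(** Over triples (k, i, j), let u be the overlap times p_i and x = q_j / p_i. The relative entropies
    add up to - sum u ln x and the resolvents to sum u / (s + x). Lifting test operators compares
    the resolvents for every s, and [resolvent_ln_le2] passes to logarithms; equal traces mean equal
    total weights. Two index sets allow a joint state to be compared with the family of its
    conditional states. *)
Lemma q_relent_compare (I I' T T' : finType)
  (P Q : I -> q_eigsys T) (P' Q' : I' -> q_eigsys T') :
  (forall k, q_dominates (Q k) (P k)) ->
  (forall k, q_dominates (Q' k) (P' k)) ->
  \sum_k \sum_i ev (P k) i = \sum_k \sum_i ev (P' k) i ->
  (forall (s : R) (K' : I' -> q_op R T'), 0 < s -> exists K : I -> q_op R T,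
    \sum_k q_J s (q_ofeig (P' k)) (q_ofeig (Q' k)) (K' k) <=
    \sum_k q_J s (q_ofeig (P k)) (q_ofeig (Q k)) (K k)) ->
  \sum_k q_relent (P' k) (Q' k) <= \sum_k q_relent (P k) (Q k).
Proof.
move=> dom dom' trE HK.
pose u (J S : finType) (P Q : J -> q_eigsys S) (m : J * (S * S)) : R :=
  q_overlap (P m.1) (Q m.1) m.2.1 m.2.2 * ev (P m.1) m.2.1.
(* The value 1 at zero weight keeps all points positive; at nonzero weight, domination makes both
   eigenvalues positive. *)
pose x (J S : finType) (P Q : J -> q_eigsys S) (m : J * (S * S)) : R :=
  if u J S P Q m == 0 then 1 else ev (Q m.1) m.2.2 / ev (P m.1) m.2.1.
have sumE (J S : finType) (F : J -> S -> S -> R) :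
    \sum_k \sum_i \sum_j F k i j = \sum_(m : J * (S * S)) F m.1 m.2.1 m.2.2.
  under eq_bigr => k _ do rewrite (pair_bigA _ (F k)).
  by rewrite (pair_bigA _ (fun k (q : S * S) => F k q.1 q.2)).
have pq (J S : finType) (A B : J -> q_eigsys S) m :
    (forall k, q_dominates (B k) (A k)) -> u J S A B m != 0 ->
    0 < ev (A m.1) m.2.1 /\ 0 < ev (B m.1) m.2.2.
  move=> domAB um; split; rewrite lt_neqAle ev_ge0 andbT eq_sym.
    by apply: contra_neq um => h; rewrite /u h mulr0.
  by apply: contra_neq um; exact: domAB.
have x_gt0 (J S : finType) (A B : J -> q_eigsys S) m :
    (forall k, q_dominates (B k) (A k)) -> 0 < x J S A B m.
  move=> domAB; rewrite /x; case: ifPn => // um.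
  by have [A0 B0] := pq _ _ _ _ _ domAB um; exact: divr_gt0.
have sumu (J S : finType) (A B : J -> q_eigsys S) :
    \sum_m u J S A B m = \sum_k \sum_i ev (A k) i.
  rewrite /u -(sumE _ _ (fun k i j => q_overlap (A k) (B k) i j * ev (A k) i)).
  apply: eq_bigr => k _; apply: eq_bigr => i _.
  by rewrite -mulr_suml q_overlap_suml mul1r.
have relE (J S : finType) (A B : J -> q_eigsys S) :
    (forall k, q_dominates (B k) (A k)) ->
    \sum_k q_relent (A k) (B k) = - \sum_m u J S A B m * ln (x J S A B m).
  move=> domAB; rewrite /q_relent sumE -sumrN; apply: eq_bigr => m _.
  rewrite -/(u J S A B m) /x; case: ifPn => [/eqP ->|um].
    by rewrite !mul0r oppr0.
  have [A0 B0] := pq _ _ _ _ _ domAB um.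
  by rewrite ln_div ?posrE// -mulrN opprB.
have resE (J S : finType) (A B : J -> q_eigsys S) (s : R) : 0 < s ->
    (forall k, q_dominates (B k) (A k)) ->
    \sum_k \sum_i \sum_j q_overlap (A k) (B k) i j * ev (A k) i ^+ 2
       / (s * ev (A k) i + ev (B k) j)
    = \sum_m u J S A B m / (s + x J S A B m).
  move=> s0 domAB; rewrite sumE; apply: eq_bigr => m _.
  rewrite expr2 mulrA -/(u J S A B m) /x; case: ifPn => [/eqP ->|um].
    by rewrite !mul0r.
  have [A0 B0] := pq _ _ _ _ _ domAB um.
  field; rewrite gt_eqF//=.
  by rewrite gt_eqF// addr_gt0// mulr_gt0.
rewrite !relE// lerN2.
apply: resolvent_ln_le2 => [m|m||s s0].
- exact: x_gt0.
- exact: x_gt0.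
- by rewrite !sumu.
rewrite -!resE//.
(* Maximisers are taken on the primed side; their lifts are bounded by the maximum on the other
   side. *)
have [K' K'E] := choice (fun k => q_J_attained (P' k) (Q' k) s0).
have [K hK] := HK s K' s0.
rewrite -(eq_bigr _ (fun k _ => K'E k)).
by apply: (le_trans hK); apply: ler_sum => k _; exact: q_J_le.
Qed.

End Operators.
Arguments q_eigsys R T : clear implicits.

(** * Characteristic polynomials of A B and B A *)

Lemma char_poly_tr (F : comNzRingType) n (A : 'M[F]_n) :
  char_poly A^T = char_poly A.
Proof.
rewrite /char_poly -det_tr; congr (\det _).
by apply/matrixP => i j; rewrite !mxE eq_sym.
Qed.

(** Sylvester's identity: in the block matrix with rows (X, A) and (B, 1), clearing B by a column
    operation leaves det (X - A B); clearing it by a row operation, which costs a factor X^n, leaves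
    X^m det (X - B A). *)
Lemma char_poly_mulC (F : comNzRingType) m n (A : 'M[F]_(m, n))
    (B : 'M[F]_(n, m)) :
  'X^n * char_poly (A *m B) = 'X^m * char_poly (B *m A).
Proof.
pose a := map_mx polyC A; pose b := map_mx polyC B.
pose M := block_mx ('X%:M) a b (1%:M).
have M1 : \det M = char_poly (A *m B).
  have : \det (M *m block_mx 1%:M 0 (- b) 1%:M) = \det M.
    by rewrite det_mulmx det_lblock !det1 !mulr1.
  rewrite mulmx_block !mulmx1 !mulmx0 !mul1mx add0r add0r mulmxN subrr.
  rewrite det_ublock det1 mulr1 => <-.
  by rewrite /char_poly /char_poly_mx map_mxM.
have : \det (block_mx 1%:M 0 (- b) 'X%:M *m M) = 'X^n * \det M.
  by rewrite det_mulmx det_lblock det1 mul1r det_scalar.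
rewrite mulmx_block !mul1mx !mul0mx !mulmx1 !addr0 mul_mx_scalar.
rewrite mul_scalar_mx scalerN addNr det_ublock det_scalar M1 => <-.
by rewrite /char_poly /char_poly_mx map_mxM mulNmx addrC.
Qed.

(** * Spectral theorem, Gram factorisations and entropy *)

Section Entropy.
Context {R : realType}.
Local Notation C := R[i].
Implicit Types (T : finType).

Lemma conj_complexE (a b : R) : (a +i* b : C)^* = a -i* b.
Proof. by []. Qed.

Lemma q_form_polar T (X : q_op R T) (u v : T -> C) (c : C) :
  q_form X (fun x => u x + c * v x) (fun x => u x + c * v x) =
  q_form X u u + c * q_form X u v + c^* * q_form X v u + c * c^* * q_form X v v.
Proof.
rewrite /q_form !mulr_sumr -!big_split /=; apply: eq_bigr => x _.
rewrite !mulr_sumr -!big_split /=; apply: eq_bigr => y _.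
by rewrite rmorphD rmorphM /=; ring.
Qed.

Lemma q_form_delta T (X : q_op R T) x y :
  q_form X (fun z => (x == z)%:R) (fun z => (y == z)%:R) = X x y.
Proof.
rewrite /q_form.
under eq_bigr => x' _ do under eq_bigr => y' _ do
  rewrite -mulrA conjC_nat [_ * (y == y')%:R]mulrC.
under eq_bigr => x' _ do rewrite -mulr_sumr sum_delta.
by rewrite sum_delta.
Qed.

(** Polarisation: a nonnegative complex number is real, and reality of the form at u, v, u + v and u
    + i v relates the real and imaginary parts of the two entries. *)
Lemma q_psd_hermitian T (X : q_op R T) : q_psd X -> q_hermitian X.
Proof.
move=> psd.
have im u : complex.Im (q_form X u u) = 0 by apply/ger0_Im/psd.
move=> x y.
rewrite -(q_form_delta X x y) -(q_form_delta X y x).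
set u := (fun z => (x == z)%:R); set v := (fun z => (y == z)%:R).
have uu := im u; have vv := im v.
have h1 := im (fun x => u x + 1 * v x).
have h2 := im (fun x => u x + 'i%C * v x).
move: h1 h2; rewrite !q_form_polar !conj_complexE.
move: uu vv; case: (q_form X u u) (q_form X v v) (q_form X u v) (q_form X v u)
  => [a a'] [b b'] [c c'] [e e'] /= -> -> h1 h2.
apply/eqP; rewrite conj_complexE eq_complex /=; apply/andP; split; apply/eqP; lra.
Qed.

Lemma q_psd_eig T (X : q_op R T) : q_psd X -> exists E, X = q_ofeig E.
Proof.
move=> psd; have herm := q_psd_hermitian psd.
pose A := q_mx_of X; pose P := spectralmx A; pose D := spectral_diag A.
have hA : A \is hermsymmx.
  apply/is_hermitianmxP; rewrite expr0 scale1r; apply/matrixP => i j.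
  by rewrite !mxE herm.
have PU : P \is unitarymx := spectral_unitarymx A.
have AE : A = invmx P *m diag_mx D *m P.
  exact/orthomx_spectralP/hermitian_normalmx.
have PAP : P *m A *m map_mx Num.conj P^T = diag_mx D.
  rewrite {1}AE invmx_unitary// !mulmxA (unitarymxP PU) mul1mx.
  by rewrite -mulmxA (unitarymxP PU) mulmx1.
(* The eigenvectors are the columns of the inverse of the unitary P, that is, its conjugated rows;
   the eigenvalues are values of the form on them, hence nonnegative. *)
pose e i x : C := (P (enum_rank i) (enum_rank x))^*.
have onb : q_onb e.
  move=> i j; have /matrixP/(_ (enum_rank i) (enum_rank j)) := unitarymxP PU.
  rewrite !mxE (inj_eq enum_rank_inj) => <-.
  rewrite /q_inner -[LHS]sum_enum_val; apply: eq_bigr => k _.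
  by rewrite /e !mxE conjCK enum_valK.
have DE i : D 0 (enum_rank i) = q_form X (e i) (e i).
  have /matrixP/(_ (enum_rank i) (enum_rank i)) := PAP.
  rewrite [X in _ = X]mxE eqxx mulr1n => <-.
  rewrite mxE /q_form exchange_big -[RHS]sum_enum_val; apply: eq_bigr => y _.
  rewrite mxE mulr_suml -[RHS]sum_enum_val; apply: eq_bigr => x _.
  by rewrite !mxE /e conjCK !enum_valK.
have D0 i : 0 <= D 0 (enum_rank i) by rewrite DE; exact: psd.
have D0' i : 0 <= complex.Re (D 0 (enum_rank i)).
  by have := D0 i; rewrite lecE => /andP[].
exists (QEigSys D0' onb); apply/funext => x; apply/funext => y.
have /matrixP/(_ (enum_rank x) (enum_rank y)) := AE.
rewrite mxE !enum_rankK => ->; rewrite /q_ofeig /=.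
rewrite mxE -[RHS]sum_enum_val; apply: eq_bigr => k _ /=.
rewrite invmx_unitary// mul_mx_diag !mxE /e conjCK enum_valK.
rewrite RRe_real; first by ring.
by have := D0 (enum_val k); rewrite enum_valK => /ger0_real.
Qed.

(** [q_eigs] picks one list of roots of the characteristic polynomial; any other factorisation is a
    permutation of it. *)
Lemma q_entropy_roots T (X : q_op R T) (s : seq C) :
  char_poly (q_mx_of X) = \prod_(l <- s) ('X - l%:P) ->
  q_entropy X = - \sum_(l <- s) xlog2x (complex.Re l).
Proof.
move=> Xs; rewrite /q_entropy; congr (- _); apply: perm_big.
apply: prod_XsubC_eq; rewrite -Xs /q_eigs.
case: closed_field_poly_normal => r /= {1}->.
by rewrite (monicP (char_poly_monic _)) scale1r.
Qed.

Lemma char_poly_eigs T (X : q_op R T) :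
  char_poly (q_mx_of X) = \prod_(l <- q_eigs X) ('X - l%:P).
Proof.
rewrite /q_eigs; case: closed_field_poly_normal => r /= {1}->.
by rewrite (monicP (char_poly_monic _)) scale1r.
Qed.

(** Write the operator as U (D V) with V U = 1: swapping the two square factors preserves the
    characteristic polynomial and leaves that of the diagonal matrix D. *)
Lemma q_entropy_ofeig T (E : q_eigsys R T) :
  q_entropy (q_ofeig E) = - \sum_i xlog2x (ev E i).
Proof.
pose s := [seq ((ev E i)%:C : C) | i <- enum T].
rewrite (@q_entropy_roots _ _ s); first by rewrite big_map big_enum.
pose U : 'M[C]_#|T| := \matrix_(i, j) evec E (enum_val j) (enum_val i).
pose D : 'rV[C]_#|T| := \row_j (ev E (enum_val j))%:C.
pose V : 'M[C]_#|T| := (\matrix_(i, j) (evec E (enum_val i) (enum_val j))^*).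
have XE : q_mx_of (q_ofeig E) = U *m (diag_mx D *m V).
  apply/matrixP => i j; rewrite !mxE /q_ofeig -[LHS]sum_enum_val.
  by apply: eq_bigr => k _; rewrite mul_diag_mx !mxE; ring.
have VU : V *m U = 1%:M.
  apply/matrixP => i j; rewrite !mxE.
  transitivity (q_inner (evec E (enum_val i)) (evec E (enum_val j))).
    by rewrite /q_inner -[RHS]sum_enum_val; apply: eq_bigr => k _; rewrite !mxE.
  by rewrite evec_onb (inj_eq enum_val_inj).
have := char_poly_mulC U (diag_mx D *m V).
rewrite -XE -mulmxA VU mulmx1.
move/(mulfI (monic_neq0 (monicXn _ _))) => ->.
rewrite char_poly_trig ?diag_mx_is_trig// /s big_map big_enum /=.
transitivity (\prod_(i < #|T|) ('X - ((ev E (enum_val i))%:C)%:P)).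
  by apply: eq_bigr => i _; rewrite !mxE eqxx mulr1n.
by rewrite -(big_enum_val (A := T) (fun x => 'X - ((ev E x)%:C)%:P)).
Qed.

(** If V is read as a pure state on T and S, this is its reduction to T. *)
Definition q_gram T (S : finType) (V : T -> S -> C) : q_op R T :=
  fun x y => \sum_k V x k * (V y k)^*.

Lemma q_gram_psd T (S : finType) (V : T -> S -> C) : q_psd (q_gram V).
Proof.
move=> v; rewrite /q_gram.
under eq_bigr => x _ do under eq_bigr => y _ do rewrite mulr_sumr mulr_suml.
under eq_bigr => x _ do rewrite exchange_big /=.
rewrite exchange_big /=; apply: sumr_ge0 => k _.
rewrite (_ : \sum_x _ = (\sum_x (v x)^* * V x k) * (\sum_x (v x)^* * V x k)^*).
  by rewrite -normCK exprn_ge0.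
rewrite mulr_suml; apply: eq_bigr => x _.
rewrite rmorph_sum mulr_sumr; apply: eq_bigr => y _.
by rewrite rmorphM /= conjCK; ring.
Qed.

Lemma q_psd_gram T (X : q_op R T) : q_psd X ->
  exists V : T -> T -> C, X = q_gram V.
Proof.
move=> /q_psd_eig[E ->].
exists (fun x i => (Num.sqrt (ev E i))%:C * evec E i x).
apply/funext => x; apply/funext => y; apply: eq_bigr => i _.
rewrite rmorphM /= conj_real_complex -{1}(sqr_sqrtr (ev_ge0 E i)) expr2 rmorphM.
by rewrite /=; ring.
Qed.

(** Up to transposition the two operators are A B and B A, whose spectra differ only by zeros, and
    [xlog2x] vanishes at 0. This is the equality of the entropies of the two halves of a pure
    state. *)
Lemma q_entropy_gram_tr T (S : finType) (V : T -> S -> C) :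
  q_entropy (q_gram V) = q_entropy (q_gram (fun k x => V x k)).
Proof.
pose A : 'M[C]_(#|T|, #|S|) := \matrix_(i, j) V (enum_val i) (enum_val j).
pose B : 'M[C]_(#|S|, #|T|) := \matrix_(i, j) (V (enum_val j) (enum_val i))^*.
have AB : q_mx_of (q_gram V) = A *m B.
  apply/matrixP => i j; rewrite !mxE /q_gram -[LHS]sum_enum_val.
  by apply: eq_bigr => k _; rewrite !mxE.
have BA : q_mx_of (q_gram (fun k x => V x k)) = (B *m A)^T.
  apply/matrixP => i j; rewrite !mxE /q_gram -[LHS]sum_enum_val.
  by apply: eq_bigr => k _; rewrite !mxE mulrC.
have := char_poly_mulC A B; rewrite -AB -(char_poly_tr (B *m A)) -BA.
rewrite !char_poly_eigs => E.
have pad n (s : seq C) :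
    'X^n * \prod_(l <- s) ('X - l%:P) = \prod_(l <- nseq n 0 ++ s) ('X - l%:P).
  rewrite big_cat /= big_nseq; congr (_ * _).
  by rewrite subr0 -[RHS]/(iter n _ 1) iter_mulr_1.
rewrite !pad in E; move/prod_XsubC_eq: E => E.
have padS n (s : seq C) : \sum_(l <- s) xlog2x (complex.Re l) =
    \sum_(l <- nseq n 0 ++ s) xlog2x (complex.Re l).
  rewrite big_cat /= big_nseq /xlog2x eqxx.
  by rewrite (_ : iter _ _ _ = 0) ?add0r//; elim: n => //= n ->; rewrite addr0.
rewrite /q_entropy (padS #|S|) [in RHS](padS #|T|).
by rewrite (perm_big _ E).
Qed.

Lemma xlog2xE (r : R) : xlog2x r = r * ln r / ln 2.
Proof. by rewrite /xlog2x; case: eqP => [->|_]; rewrite ?mul0r// mulrA. Qed.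

End Entropy.

(** * Relative entropy expressed through entropies *)

Section RelativeEntropy.
Context {R : realType}.
Local Notation C := R[i].
Implicit Types (T : finType).

Lemma ln2_gt0 : 0 < ln 2 :> R.
Proof. by rewrite ln_gt0// ltr1n. Qed.

Lemma q_entropy_nat T (E : q_eigsys R T) :
  ln 2 * q_entropy (q_ofeig E) = - \sum_i ev E i * ln (ev E i).
Proof.
rewrite q_entropy_ofeig mulrN mulr_sumr; congr (- _); apply: eq_bigr => i _.
by rewrite xlog2xE mulrCA divff ?mulr1// gt_eqF// ln2_gt0.
Qed.

Lemma q_normsq_bool (b : bool) : q_normsq (b%:R : C) = b%:R.
Proof. by case: b; rewrite /q_normsq /= ?expr1n expr0n /= addr0. Qed.

Lemma q_form_evec T (E : q_eigsys R T) j :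
  q_form (q_ofeig E) (evec E j) (evec E j) = (ev E j)%:C.
Proof.
rewrite q_form_ofeig; congr (_%:C).
rewrite (bigD1 j)//= evec_onb eqxx q_normsq_bool mulr1 big1 ?addr0// => i ij.
by rewrite evec_onb eq_sym (negPf ij) q_normsq_bool mulr0.
Qed.

(** The overlaps of each e_i sum to 1 over j, and weighting the p_i by the overlaps with f_j gives
    the diagonal entry <f_j|rho|f_j>. *)
Lemma q_relentE T (P Q : q_eigsys R T) :
  q_relent P Q = \sum_i ev P i * ln (ev P i)
  - \sum_j complex.Re (q_form (q_ofeig P) (evec Q j) (evec Q j)) * ln (ev Q j).
Proof.
under [X in _ = _ - X]eq_bigr => j _ do rewrite q_form_ofeig Re_real mulr_suml.
rewrite exchange_big -sumrB; apply: eq_bigr => i _ /=.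
rewrite -[X in X - _]mul1r -(q_overlap_suml P Q i) mulr_suml -sumrB.
by apply: eq_bigr => j _; rewrite /q_overlap; ring.
Qed.

Lemma q_dominates_form T (P Q : q_eigsys R T) :
  (forall j, ev Q j = 0 ->
     complex.Re (q_form (q_ofeig P) (evec Q j) (evec Q j)) = 0) ->
  q_dominates Q P.
Proof.
move=> h i j /h; rewrite q_form_ofeig Re_real => /eqP.
rewrite psumr_eq0 => [/allP/(_ i)|k _]; last first.
  by rewrite mulr_ge0 ?ev_ge0 ?q_normsq_ge0.
by rewrite mem_index_enum => /(_ isT)/eqP; rewrite mulrC.
Qed.

Lemma Re_q_form_ge0 T (P : q_eigsys R T) u :
  0 <= complex.Re (q_form (q_ofeig P) u u).
Proof.
rewrite q_form_ofeig Re_real; apply: sumr_ge0 => i _.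
by rewrite mulr_ge0 ?ev_ge0 ?q_normsq_ge0.
Qed.

Lemma q_form_sum T (I : finType) (X : I -> q_op R T) u v :
  q_form (fun x y => \sum_k X k x y) u v = \sum_k q_form (X k) u v.
Proof.
rewrite /q_form [RHS]exchange_big; apply: eq_bigr => x _ /=.
rewrite [RHS]exchange_big; apply: eq_bigr => y _ /=.
by rewrite mulr_sumr mulr_suml.
Qed.

Lemma q_tr2_sum T (I : finType) (X : I -> q_op R T) K :
  q_tr2 (fun x y => \sum_k X k x y) K = \sum_k q_tr2 (X k) K.
Proof.
rewrite /q_tr2 [RHS]exchange_big; apply: eq_bigr => x _ /=.
rewrite [RHS]exchange_big; apply: eq_bigr => y _ /=.
by rewrite mulr_suml.
Qed.

Lemma q_psd_sum T (I : finType) (X : I -> q_op R T) :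
  (forall k, q_psd (X k)) -> q_psd (fun x y => \sum_k X k x y).
Proof.
move=> h v; rewrite -/(q_form _ v v) q_form_sum.
by apply: sumr_ge0 => k _; exact: h.
Qed.

Lemma q_trace_ofeig T (E : q_eigsys R T) :
  q_trace (q_ofeig E) = (\sum_i ev E i)%:C.
Proof.
rewrite /q_trace /q_ofeig exchange_big rmorph_sum; apply: eq_bigr => i _ /=.
rewrite -mulr_sumr -[RHS]mulr1; congr (_ * _).
transitivity (q_inner (evec E i) (evec E i)); last by rewrite evec_onb eqxx.
by apply: eq_bigr => x _; rewrite mulrC.
Qed.

Definition q_scale T (c : R) (c0 : 0 <= c) (E : q_eigsys R T) :=
  QEigSys (fun i => mulr_ge0 c0 (ev_ge0 E i)) (evec_onb E).

Lemma q_ofeig_scale T (c : R) (c0 : 0 <= c) (E : q_eigsys R T) :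
  q_ofeig (q_scale c0 E) = fun x y => c%:C * q_ofeig E x y.
Proof.
apply/funext => x; apply/funext => y; rewrite /q_ofeig mulr_sumr.
by apply: eq_bigr => i _ /=; rewrite rmorphM /= -mulrA.
Qed.

Lemma q_tr2_scale T (c : C) (X K : q_op R T) :
  q_tr2 (fun x y => c * X x y) K = c * q_tr2 X K.
Proof.
rewrite /q_tr2 mulr_sumr; apply: eq_bigr => x _; rewrite mulr_sumr.
by apply: eq_bigr => y _; rewrite mulrA.
Qed.

Section Mixture.
Variables (T I : finType) (P : I -> q_eigsys R T) (Q : q_eigsys R T).
Variables (c : R) (c0 : 0 < c).
Hypothesis QE : q_ofeig Q = fun x y => \sum_k q_ofeig (P k) x y.

Lemma mixture_formE j :
  \sum_k complex.Re (q_form (q_ofeig (P k)) (evec Q j) (evec Q j)) = ev Q j.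
Proof.
by rewrite -Re_sum -(q_form_sum (fun k => q_ofeig (P k))) -QE q_form_evec.
Qed.

Lemma mixture_dominates k : q_dominates (q_scale (ltW c0) Q) (P k).
Proof.
apply: q_dominates_form => j /= /eqP.
rewrite mulf_eq0 gt_eqF//= => /eqP; rewrite -mixture_formE => /eqP.
rewrite psumr_eq0 => [/allP/(_ k)|i _]; last exact: Re_q_form_ge0.
by rewrite mem_index_enum => /(_ isT)/eqP.
Qed.

(** The second argument is the same for all k: in its eigenbasis the diagonals of the [P k] add up
    to the eigenvalues of [Q]. Used with c a bound on overlaps, and with c = 1. *)
Lemma mixture_relent :
  \sum_k q_relent (P k) (q_scale (ltW c0) Q) =
  ln 2 * (q_entropy (q_ofeig Q) - \sum_k q_entropy (q_ofeig (P k)))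
  - ln c * \sum_i ev Q i.
Proof.
have -> : \sum_k q_relent (P k) (q_scale (ltW c0) Q) =
    \sum_k \sum_i ev (P k) i * ln (ev (P k) i) - \sum_j ev Q j * ln (c * ev Q j).
  under eq_bigr => k _ do rewrite q_relentE /=.
  rewrite sumrB; congr (_ - _); rewrite exchange_big /=.
  by apply: eq_bigr => j _; rewrite -mulr_suml mixture_formE.
have -> : ln 2 * (q_entropy (q_ofeig Q) - \sum_k q_entropy (q_ofeig (P k))) =
    \sum_k \sum_i ev (P k) i * ln (ev (P k) i) - \sum_j ev Q j * ln (ev Q j).
  rewrite mulrBr q_entropy_nat addrC mulr_sumr -sumrN; congr (_ - _).
  by apply: eq_bigr => k _; rewrite q_entropy_nat opprK.
rewrite -addrA -opprD; congr (_ - _).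
rewrite mulr_sumr -big_split /=; apply: eq_bigr => j _.
have := ev_ge0 Q j; rewrite le_eqVlt => /predU1P[<-|q0].
  by rewrite !(mul0r, mulr0) addr0.
by rewrite lnM ?posrE//; ring.
Qed.

End Mixture.

Lemma mixture_trace T (I : finType) (P : I -> q_eigsys R T) (Q : q_eigsys R T) :
  q_ofeig Q = (fun x y => \sum_k q_ofeig (P k) x y) ->
  \sum_k \sum_i ev (P k) i = \sum_i ev Q i.
Proof.
move=> QE; apply: (@complexI R); rewrite -q_trace_ofeig QE /q_trace [RHS]exchange_big.
by rewrite rmorph_sum; apply: eq_bigr => k _; rewrite /= -q_trace_ofeig.
Qed.

End RelativeEntropy.

(** * Measurements of A and uncertainty with one memory *)

Section Measurement.
Context {R : realType}.
Local Notation C := R[i].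

Lemma sum_pair (V : nmodType) (I J : finType) (F : I * J -> V) :
  \sum_p F p = \sum_i \sum_j F (i, j).
Proof. by rewrite (pair_bigA _ (fun i j => F (i, j))); apply: eq_bigr => -[]. Qed.

Definition q_prod (I J : finType) (u : I -> C) (v : J -> C) : I * J -> C :=
  fun p => u p.1 * v p.2.

Lemma q_inner_prod (I J : finType) (u u' : I -> C) (v v' : J -> C) :
  q_inner (q_prod u v) (q_prod u' v') = q_inner u u' * q_inner v v'.
Proof.
rewrite /q_inner sum_pair mulr_suml; apply: eq_bigr => i _.
rewrite mulr_sumr; apply: eq_bigr => j _.
by rewrite /q_prod rmorphM /=; ring.
Qed.

(** The unnormalised state of the second system when the first is found in u. *)
Definition q_blk (I J : finType) (u : I -> C) (X : q_op R (I * J)%type) : q_op R J :=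
  fun y y' => \sum_a \sum_a' (u a)^* * X (a, y) (a', y') * u a'.

Lemma q_form_blk (I J : finType) (u : I -> C) (X : q_op R (I * J)%type) v w :
  q_form (q_blk u X) v w = q_form X (q_prod u v) (q_prod u w).
Proof.
rewrite /q_form [RHS]sum_pair [RHS]exchange_big; apply: eq_bigr => y _ /=.
under [RHS]eq_bigr => a _ do rewrite sum_pair exchange_big /=.
rewrite [RHS]exchange_big; apply: eq_bigr => y' _ /=.
rewrite /q_blk mulr_sumr mulr_suml; apply: eq_bigr => a _.
rewrite mulr_sumr mulr_suml; apply: eq_bigr => a' _.
by rewrite /q_prod rmorphM /=; ring.
Qed.

Lemma q_blk_psd (I J : finType) (u : I -> C) (X : q_op R (I * J)%type) :
  q_psd X -> q_psd (q_blk u X).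
Proof. by move=> psd v; have := psd (q_prod u v); rewrite -/(q_form _ _ _) -q_form_blk. Qed.

Variables (d : nat) (Y : finType).
Implicit Types (psi : 'I_d -> 'I_d -> C) (X : q_op R ('I_d * Y)%type).

Lemma sum_q_blk psi X : q_orthonormal psi ->
  (fun y y' => \sum_k q_blk (psi k) X y y') = ptrA X.
Proof.
move=> hpsi; apply/funext => y; apply/funext => y'.
rewrite /q_blk /ptrA exchange_big; apply: eq_bigr => a _ /=.
rewrite exchange_big /= -[RHS](sum_delta (fun a' => X (a, y) (a', y'))).
apply: eq_bigr => a' _; rewrite eq_sym -(q_onb_complete hpsi) mulr_suml.
by apply: eq_bigr => k _; ring.
Qed.

Lemma q_measE psi X p q :
  q_meas psi X p q =
  \sum_k psi k p.1 * (psi k q.1)^* * q_blk (psi k) X p.2 q.2.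
Proof.
apply: eq_bigr => k _; rewrite /q_blk mulr_sumr; apply: eq_bigr => a _.
by rewrite mulr_sumr; apply: eq_bigr => a' _; rewrite /q_proj; ring.
Qed.

Section MeasEig.
Variables (psi : 'I_d -> 'I_d -> C) (hpsi : q_orthonormal psi).
Variable (E : 'I_d -> q_eigsys R Y).

Lemma meas_evec_onb : q_onb (fun (p : 'I_d * Y) => q_prod (psi p.1) (evec (E p.1) p.2)).
Proof.
move=> [k y] [l y'] /=; rewrite q_inner_prod hpsi xpair_eqE.
by case: eqP => [<-|_]; rewrite ?mul0r// mul1r evec_onb.
Qed.

(** The measured state is block diagonal, so it is diagonalised by products of psi_k with
    eigenvectors of the k-th conditional state. *)
Definition meas_eig : q_eigsys R ('I_d * Y)%type :=
  QEigSys (fun p : 'I_d * Y => ev_ge0 (E p.1) p.2) meas_evec_onb.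

Lemma q_meas_eig X : (forall k, q_blk (psi k) X = q_ofeig (E k)) ->
  q_meas psi X = q_ofeig meas_eig.
Proof.
move=> XE; apply/funext => p; apply/funext => q.
rewrite q_measE /q_ofeig sum_pair; apply: eq_bigr => k _.
rewrite XE /q_ofeig mulr_sumr; apply: eq_bigr => y _.
by rewrite /= /q_prod rmorphM /=; ring.
Qed.

Lemma q_entropy_meas_eig :
  q_entropy (q_ofeig meas_eig) = \sum_k q_entropy (q_ofeig (E k)).
Proof.
rewrite q_entropy_ofeig.
rewrite sum_pair /= -sumrN.
by apply: eq_bigr => k _; rewrite q_entropy_ofeig.
Qed.

End MeasEig.

Lemma q_entropy_meas psi X : q_psd X -> q_orthonormal psi ->
  q_entropy (q_meas psi X) = \sum_k q_entropy (q_blk (psi k) X).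
Proof.
move=> psd hpsi.
have [E XE] := choice (fun k => q_psd_eig (q_blk_psd (psi k) psd)).
rewrite (q_meas_eig hpsi XE) q_entropy_meas_eig.
by apply: eq_bigr => k _; rewrite XE.
Qed.

(** The sum over l of |psi_l><psi_l| tensor K_l, which combines one test operator per outcome into
    one on the joint system. *)
Definition q_lift (I J : finType) (psi : I -> I -> C) (K : I -> q_op R J) :
    q_op R (I * J)%type :=
  fun p q => \sum_l psi l p.1 * (psi l q.1)^* * K l p.2 q.2.

Lemma q_lift_mul psi (K L : 'I_d -> q_op R Y) : q_orthonormal psi ->
  q_mul (q_lift psi K) (q_lift psi L) = q_lift psi (fun l => q_mul (K l) (L l)).
Proof.
move=> hpsi; apply/funext => p; apply/funext => q; rewrite /q_mul /q_lift.
rewrite sum_pair.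
transitivity (\sum_l \sum_l' (l == l')%:R *
   (psi l p.1 * (psi l' q.1)^* * \sum_y K l p.2 y * L l' y q.2)); last first.
  by apply: eq_bigr => l _; rewrite sum_delta.
under [RHS]eq_bigr => l _ do under eq_bigr => l' _ do
  rewrite -hpsi /q_inner mulr_suml.
under [RHS]eq_bigr => l _ do rewrite exchange_big /=.
rewrite [RHS]exchange_big /=; apply: eq_bigr => a _.
under eq_bigr => y _ do rewrite mulr_suml.
rewrite exchange_big /=; apply: eq_bigr => l _.
under eq_bigr => y _ do rewrite mulr_sumr.
rewrite exchange_big /=; apply: eq_bigr => l' _.
by rewrite !mulr_sumr; apply: eq_bigr => y _; ring.
Qed.

Lemma q_lift_adj psi (K : 'I_d -> q_op R Y) :
  q_adj (q_lift psi K) = q_lift psi (fun l => q_adj (K l)).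
Proof.
apply/funext => p; apply/funext => q; rewrite /q_adj /q_lift rmorph_sum.
by apply: eq_bigr => l _; rewrite !rmorphM /= conjCK; ring.
Qed.

Lemma q_tr2_lift psi (K : 'I_d -> q_op R Y) X :
  q_tr2 X (q_lift psi K) = \sum_l q_tr2 (q_blk (psi l) X) (K l).
Proof.
rewrite /q_tr2 sum_pair.
under eq_bigr => a _ do under eq_bigr => y _ do rewrite sum_pair.
transitivity (\sum_a \sum_y \sum_a' \sum_y' \sum_l
   (psi l a)^* * X (a, y) (a', y') * psi l a' * K l y' y).
  do 4! apply: eq_bigr => ? _.
  by rewrite /q_lift mulr_sumr; apply: eq_bigr => l _ /=; ring.
under eq_bigr => a _ do under eq_bigr => y _ do
  (under eq_bigr => a' _ do rewrite exchange_big /=; rewrite exchange_big /=).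
under eq_bigr => a _ do rewrite exchange_big /=.
rewrite exchange_big /=; apply: eq_bigr => l _.
rewrite exchange_big /=; apply: eq_bigr => y _.
under eq_bigr => a _ do rewrite exchange_big /=.
rewrite exchange_big /=; apply: eq_bigr => y' _.
rewrite /q_blk mulr_suml; apply: eq_bigr => a _.
by rewrite mulr_suml.
Qed.

(** A later outcome x sees the blocks of z with weights |<x|z_k>|^2; this is where the overlaps of
    the two bases enter. *)
Lemma q_blk_meas (x : 'I_d -> C) z X :
  q_blk x (q_meas z X) =
  fun y y' => \sum_k (q_normsq (q_inner x (z k)))%:C * q_blk (z k) X y y'.
Proof.
apply/funext => y; apply/funext => y'; rewrite {1}/q_blk.
under eq_bigr => a _ do under eq_bigr => a' _ do
  rewrite q_measE mulr_sumr mulr_suml.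
under eq_bigr => a _ do rewrite exchange_big /=.
rewrite exchange_big /=; apply: eq_bigr => k _.
rewrite -mul_conj_normsq -q_innerC /q_inner big_distrlr /= mulr_suml.
apply: eq_bigr => a _; rewrite mulr_suml; apply: eq_bigr => a' _; ring.
Qed.

Lemma q_trace_ptrA X : q_trace (ptrA X) = q_trace X.
Proof. by rewrite /q_trace /ptrA sum_pair exchange_big. Qed.

Let mul_rearrange (L a b e f l : R) :
  L * (f - e) - l <= L * (a - b) -> L * - (a - b + (e - f)) <= l.
Proof. lra. Qed.

(** In the eigenbasis of the z-measured state the diagonal of X is the spectrum of that state, so
    the relative entropy of X to it is a difference of entropies. It dominates the sum of the
    relative entropies of the conditional states of x to c times the memory state, which
    [mixture_relent] evaluates. *)
Lemma uncertainty_with_memory X x z c :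
  q_psd X -> q_trace X = 1 -> q_orthonormal x -> q_orthonormal z -> 0 < c ->
  (forall l k, q_normsq (q_inner (x l) (z k)) <= c) ->
  - log2 c <= q_entropy (q_meas z X) - q_entropy X
              + (q_entropy (q_meas x X) - q_entropy (ptrA X)).
Proof.
move=> psd tr1 hx hz c0 hc.
have [E XE] := q_psd_eig psd.
have [Ex ExE] := choice (fun k => q_psd_eig (q_blk_psd (x k) psd)).
have [Ez EzE] := choice (fun k => q_psd_eig (q_blk_psd (z k) psd)).
have [Q QE] := q_psd_eig (q_psd_sum (fun k => q_blk_psd (x k) psd)).
have QEx : q_ofeig Q = fun y y' => \sum_k q_ofeig (Ex k) y y'.
  by rewrite -QE; apply/funext => y; apply/funext => y'; apply: eq_bigr => k _;
    rewrite ExE.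
have PQ : ptrA X = q_ofeig Q by rewrite -(sum_q_blk X hx).
pose M := meas_eig hz Ez.
have MX : q_meas z X = q_ofeig M := q_meas_eig hz EzE.
have formM p : complex.Re (q_form (q_ofeig E) (evec M p) (evec M p)) = ev M p.
  by rewrite -XE -q_form_blk EzE q_form_evec.
have trQ : \sum_i ev Q i = 1.
  by apply: (@complexI R); rewrite -q_trace_ofeig -PQ q_trace_ptrA tr1.
have trE : \sum_i ev E i = 1.
  by apply: (@complexI R); rewrite -q_trace_ofeig -XE tr1.
have relEM : q_relent E M = ln 2 * (q_entropy (q_meas z X) - q_entropy X).
  rewrite q_relentE MX [RHS]mulrBr XE (q_entropy_nat M) (q_entropy_nat E) opprK addrC.
  congr (- _ + _).
  by apply: eq_bigr => p _; rewrite formM.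
have := @q_relent_compare R 'I_1 'I_d _ _ (fun _ => E) (fun _ => M)
  Ex (fun _ => q_scale (ltW c0) Q).
rewrite !big_ord1 relEM (mixture_relent c0 QEx) trQ mulr1 => H.
have SxE : q_entropy (q_meas x X) = \sum_k q_entropy (q_ofeig (Ex k)).
  by rewrite (q_entropy_meas psd hx); apply: eq_bigr => k _; rewrite ExE.
rewrite /log2 lerNl ler_pdivlMr ?ln2_gt0// mulrC SxE PQ; apply: mul_rearrange.
apply: H.
- move=> _; apply: q_dominates_form => p; by rewrite formM.
- exact: mixture_dominates.
- by rewrite (mixture_trace QEx) trE trQ.
(* The block diagonal lift reproduces the first two terms of [q_J] exactly; only the sigma term
   needs an estimate. *)
move=> s K s0; exists (fun _ => q_lift x K); rewrite big_ord1.
rewrite {2}/q_J -XE -MX q_lift_adj !q_lift_mul// !q_tr2_lift !Re_sum.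
rewrite !mulr_sumr -!sumrB; apply: ler_sum => l _.
rewrite /q_J ExE lerD2l lerN2 q_ofeig_scale q_tr2_scale Re_realM.
set L := q_mul _ _.
(* On the left the z-blocks carry weights at most c; on the right they all carry c, since they add
   up to the memory state. *)
rewrite q_blk_meas (q_tr2_sum (fun k y y' => _)) Re_sum.
rewrite -PQ -(sum_q_blk X hz) q_tr2_sum Re_sum mulr_sumr.
apply: ler_sum => k _; rewrite q_tr2_scale Re_realM EzE.
by apply: ler_wpM2r => //; exact: q_tr2_KKadj_ge0.
Qed.

End Measurement.

(** * Discarding part of the memory *)

Section PartialTrace.
Context {R : realType}.
Local Notation C := R[i].
Variables (Y Z : finType).

Definition q_ptr (X : q_op R (Y * Z)%type) : q_op R Y :=
  fun y y' => \sum_e X (y, e) (y', e).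

Definition q_ampl (K : q_op R Y) : q_op R (Y * Z)%type :=
  fun p q => (p.2 == q.2)%:R * K p.1 q.1.

Lemma q_ampl_adj K : q_adj (q_ampl K) = q_ampl (q_adj K).
Proof.
apply/funext => p; apply/funext => q; rewrite /q_adj /q_ampl rmorphM /=.
by rewrite conjC_nat eq_sym.
Qed.

Lemma q_ampl_mul K L : q_mul (q_ampl K) (q_ampl L) = q_ampl (q_mul K L).
Proof.
apply/funext => p; apply/funext => q; rewrite /q_mul /q_ampl sum_pair.
rewrite mulr_sumr; apply: eq_bigr => y _ /=.
transitivity (\sum_e (p.2 == e)%:R * ((e == q.2)%:R * (K p.1 y * L y q.1))).
  by apply: eq_bigr => e _; ring.
by rewrite sum_delta.
Qed.

Lemma q_tr2_ampl X K : q_tr2 X (q_ampl K) = q_tr2 (q_ptr X) K.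
Proof.
rewrite /q_tr2 /q_ptr sum_pair; apply: eq_bigr => y _.
under eq_bigr => e _ do rewrite sum_pair.
rewrite exchange_big /=; apply: eq_bigr => y' _.
rewrite mulr_suml; apply: eq_bigr => e _.
rewrite -(sum_delta (fun e' => X (y, e) (y', e') * K y' y)).
by apply: eq_bigr => e' _; rewrite /q_ampl /= eq_sym; ring.
Qed.

(** Tracing out Z from a Gram operator only moves Z to the summed index. *)
Lemma q_ptr_psd X : q_psd X -> q_psd (q_ptr X).
Proof.
move=> /q_psd_gram[V ->].
suff -> : q_ptr (q_gram V) = q_gram (fun y (p : Z * (Y * Z)) => V (y, p.1) p.2).
  exact: q_gram_psd.
by apply/funext => y; apply/funext => y'; rewrite /q_gram [RHS]sum_pair.
Qed.

Lemma q_trace_ptr X : q_trace (q_ptr X) = q_trace X.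
Proof. by rewrite /q_trace sum_pair. Qed.

(* Strong subadditivity with a classical conditioned system k:
   S(k | YZ) <= S(k | Y) for the unnormalised conditional states W k. *)
Lemma conditional_entropy_ptr (I : finType) (W : I -> q_op R (Y * Z)%type) :
  (forall k, q_psd (W k)) ->
  \sum_k q_entropy (W k) - q_entropy (fun p q => \sum_k W k p q) <=
  \sum_k q_entropy (q_ptr (W k)) - q_entropy (q_ptr (fun p q => \sum_k W k p q)).
Proof.
move=> psd.
have [P PE] := choice (fun k => q_psd_eig (psd k)).
have [Q QE] := q_psd_eig (q_psd_sum psd).
have [P' P'E] := choice (fun k => q_psd_eig (q_ptr_psd (psd k))).
have [Q' Q'E] := q_psd_eig (q_ptr_psd (q_psd_sum psd)).
have QP : q_ofeig Q = fun p q => \sum_k q_ofeig (P k) p q.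
  by rewrite -QE; apply/funext => p; apply/funext => q; apply: eq_bigr => k _;
    rewrite PE.
have QP' : q_ofeig Q' = fun p q => \sum_k q_ofeig (P' k) p q.
  rewrite -Q'E; apply/funext => p; apply/funext => q; rewrite /q_ptr exchange_big.
  by apply: eq_bigr => k _; rewrite -P'E.
have trQ : \sum_i ev Q' i = \sum_i ev Q i.
  by apply: (@complexI R); rewrite -!q_trace_ofeig -Q'E -QE q_trace_ptr.
have := @q_relent_compare R I I _ _ P (fun _ => q_scale (ltW ltr01) Q)
  P' (fun _ => q_scale (ltW ltr01) Q').
have SP : \sum_k q_entropy (W k) = \sum_k q_entropy (q_ofeig (P k)).
  by apply: eq_bigr => k _; rewrite PE.
have SP' : \sum_k q_entropy (q_ptr (W k)) = \sum_k q_entropy (q_ofeig (P' k)).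
  by apply: eq_bigr => k _; rewrite P'E.
rewrite (mixture_relent ltr01 QP) (mixture_relent ltr01 QP') ln1 !mul0r !subr0.
rewrite Q'E QE SP SP' => H.
rewrite -lerN2 !opprB -(ler_pM2l ln2_gt0); apply: H.
- exact: mixture_dominates.
- exact: mixture_dominates.
- by rewrite (mixture_trace QP) (mixture_trace QP').
(* Traces against K tensor the identity see only the reduction to Y, so all three terms of [q_J] are
   unchanged. *)
move=> s K s0; exists (fun k => q_ampl (K k)); apply: ler_sum => k _.
rewrite /q_J q_ampl_adj !q_ampl_mul !q_ofeig_scale !q_tr2_scale -PE -QE.
by rewrite !q_tr2_ampl P'E Q'E.
Qed.

End PartialTrace.

(** * Two different memories, by duality for a pure state *)

Section Tripartite.
Context {R : realType}.
Local Notation C := R[i].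
Variables (d : nat) (Y Z E : finType) (V : 'I_d * Y -> Z * E -> C).

(* V is a pure state of A Y Z E, viewed as a matrix from ZE to AY; its reduction
   to A Y is [q_gram V]. *)
Definition pure_AC : q_op R ('I_d * Z)%type :=
  fun p q => \sum_b \sum_e V (p.1, b) (p.2, e) * (V (q.1, b) (q.2, e))^*.

Lemma pure_AC_psd : q_psd pure_AC.
Proof.
have -> : pure_AC = q_gram (fun p (r : Y * E) => V (p.1, r.1) (p.2, r.2)).
  by apply/funext => p; apply/funext => q; rewrite /q_gram sum_pair.
exact: q_gram_psd.
Qed.

(** Each outcome leaves a pure state of Y and ZE, whose halves have equal entropy, and so do AY and
    ZE before the measurement. The left side is thus the entropy of the outcome given ZE, and
    discarding E cannot lower it. *)
Lemma meas_entropy_dual (z : 'I_d -> 'I_d -> C) : q_orthonormal z ->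
  q_entropy (q_meas z (q_gram V)) - q_entropy (q_gram V) <=
  q_entropy (q_meas z pure_AC) - q_entropy (ptrA pure_AC).
Proof.
move=> hz.
(* [Vz k] is the unnormalised vector left by outcome k, and [W k] its reduction to ZE. *)
pose Vz k b s := \sum_a (z k a)^* * V (a, b) s.
pose W k := q_gram (fun s b => Vz k b s).
have blkE k : q_blk (z k) (q_gram V) = q_gram (Vz k).
  apply/funext => y; apply/funext => y'; rewrite /q_blk /q_gram.
  under eq_bigr => a _ do under eq_bigr => a' _ do rewrite mulr_sumr mulr_suml.
  under eq_bigr => a _ do rewrite exchange_big /=.
  rewrite exchange_big; apply: eq_bigr => s _ /=.
  rewrite /Vz rmorph_sum big_distrlr /=; apply: eq_bigr => a _.
  by apply: eq_bigr => a' _; rewrite rmorphM /= conjCK; ring.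
have WE : (fun p q => \sum_k W k p q) = q_gram (fun s p => V p s).
  apply/funext => s; apply/funext => s'; rewrite /W /q_gram /= [RHS]sum_pair.
  rewrite [RHS]exchange_big [LHS]exchange_big; apply: eq_bigr => b _ /=.
  under eq_bigr => k _ do rewrite /Vz rmorph_sum big_distrlr /=.
  rewrite exchange_big; apply: eq_bigr => a _ /=.
  rewrite exchange_big /= -[RHS](sum_delta (fun a' => V (a, b) s * (V (a', b) s')^*)).
  apply: eq_bigr => a' _; rewrite eq_sym -(q_onb_complete hz) mulr_suml.
  by apply: eq_bigr => k _; rewrite rmorphM /= conjCK; ring.
have ptrE k : q_ptr (W k) = q_blk (z k) pure_AC.
  apply/funext => c; apply/funext => c'; rewrite /q_ptr /W /q_gram /q_blk /pure_AC.
  under [RHS]eq_bigr => a _ do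
    (under eq_bigr => a' _ do (rewrite mulr_sumr mulr_suml;
       under eq_bigr => b _ do rewrite mulr_sumr mulr_suml);
     rewrite exchange_big /=).
  rewrite [RHS]exchange_big [LHS]exchange_big; apply: eq_bigr => b _ /=.
  under [RHS]eq_bigr => a _ do rewrite exchange_big /=.
  rewrite [RHS]exchange_big; apply: eq_bigr => e _ /=.
  rewrite /Vz rmorph_sum big_distrlr /=; apply: eq_bigr => a _.
  by apply: eq_bigr => a' _; rewrite rmorphM /= conjCK; ring.
have Wpsd k : q_psd (W k) by exact: q_gram_psd.
have ptrWE : q_ptr (fun p q => \sum_k W k p q) = ptrA pure_AC.
  rewrite -(sum_q_blk pure_AC hz); apply/funext => y; apply/funext => y'.
  by rewrite /q_ptr exchange_big; apply: eq_bigr => k _; rewrite -ptrE.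
have S1 : \sum_k q_entropy (W k) = q_entropy (q_meas z (q_gram V)).
  rewrite (q_entropy_meas (@q_gram_psd _ _ _ V) hz).
  by apply: eq_bigr => k _; rewrite blkE q_entropy_gram_tr.
have S2 : \sum_k q_entropy (q_ptr (W k)) = q_entropy (q_meas z pure_AC).
  rewrite (q_entropy_meas pure_AC_psd hz).
  by apply: eq_bigr => k _; rewrite ptrE.
have := conditional_entropy_ptr Wpsd.
by rewrite S1 S2 ptrWE WE -q_entropy_gram_tr.
Qed.

Lemma uncertainty_tripartite (x z : 'I_d -> 'I_d -> C) (c : R) :
  q_trace (q_gram V) = 1 -> q_orthonormal x -> q_orthonormal z -> 0 < c ->
  (forall l k, q_normsq (q_inner (x l) (z k)) <= c) ->
  - log2 c <=
    (q_entropy (q_meas x (q_gram V)) - q_entropy (ptrA (q_gram V)))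
    + (q_entropy (q_meas z pure_AC) - q_entropy (ptrA pure_AC)).
Proof.
move=> tr1 hx hz c0 hc.
apply: le_trans (uncertainty_with_memory (@q_gram_psd _ _ _ V) tr1 hx hz c0 hc) _.
by rewrite addrC lerD2l meas_entropy_dual.
Qed.

End Tripartite.

(** * Reduced states of the joint system and their purification *)

Section Slices.
Context {R : realType}.
Local Notation C := R[i].

Variables (n : nat) (B : 'I_n -> finType).
Implicit Types (g r : Bsys n B) (s t : 'I_n).

Lemma q_upd_same g t (b : B t) : q_upd g t b t = b.
Proof. by rewrite ffunE dfwith_in. Qed.

Lemma q_upd_other g t (b : B t) s : s != t -> q_upd g t b s = g s.
Proof. by move=> st; rewrite ffunE dfwith_out// eq_sym. Qed.

Lemma q_upd_upd g t (b c : B t) : q_upd (q_upd g t b) t c = q_upd g t c.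
Proof.
apply/ffunP => s; have [->|st] := eqVneq s t; first by rewrite !q_upd_same.
by rewrite !q_upd_other.
Qed.

Lemma q_upd_id g t : q_upd g t (g t) = g.
Proof.
apply/ffunP => s; have [->|st] := eqVneq s t; first by rewrite !q_upd_same.
by rewrite !q_upd_other.
Qed.

Lemma q_upd_comm g s t (b : B s) (c : B t) : s != t ->
  q_upd (q_upd g t c) s b = q_upd (q_upd g s b) t c.
Proof.
move=> st; apply/ffunP => u; have [->|us] := eqVneq u s.
  by rewrite q_upd_same q_upd_other// q_upd_same.
rewrite [LHS]q_upd_other//; have [->|ut] := eqVneq u t.
  by rewrite !q_upd_same.
by rewrite !q_upd_other.
Qed.

(** Overwriting coordinate t is a bijection between slices. A slice at a reference value thus
    encodes the product of the other coordinates without a new index type. *)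
Lemma sum_slice t (c c0 : B t) (P : pred (Bsys n B)) (F : Bsys n B -> C) :
  (forall g b, P (q_upd g t b) = P g) ->
  \sum_(g | P g && (g t == c)) F g =
  \sum_(r | P r && (r t == c0)) F (q_upd r t c).
Proof.
move=> HP; rewrite (reindex_onto (fun r => q_upd r t c) (fun g => q_upd g t c0)).
  apply: eq_bigl => r; rewrite HP q_upd_same eqxx andbT q_upd_upd.
  congr (_ && _); apply/eqP/eqP => [<-|<-]; first by rewrite q_upd_same.
  by rewrite q_upd_id.
by move=> g /andP[_ /eqP <-]; rewrite q_upd_upd q_upd_id.
Qed.

Lemma sum_slices t (c0 : B t) (P : pred (Bsys n B)) (F : Bsys n B -> C) :
  (forall g b, P (q_upd g t b) = P g) ->
  \sum_(g | P g) F g = \sum_c \sum_(r | P r && (r t == c0)) F (q_upd r t c).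
Proof.
move=> HP; rewrite (partition_big (fun g => g t) predT)//=.
by apply: eq_bigr => c _; exact: sum_slice.
Qed.

Variable (d : nat).
Implicit Types rho : q_op R (Jsys d n B).

(** In [red_AB] the row index constrains the summed g; running over a fixed slice makes row and
    column symmetric, the shape of a Gram operator. *)
Lemma red_AB_slice rho t (b0 : B t) p q :
  red_AB rho t p q = \sum_(r : Bsys n B | r t == b0)
    rho (p.1, q_upd r t p.2) (q.1, q_upd r t q.2).
Proof.
rewrite /red_AB.
rewrite (@sum_slice t p.2 b0 xpredT (fun g => rho (p.1, g) (q.1, q_upd g t q.2)))//=.
by apply: eq_bigr => r _; rewrite q_upd_upd.
Qed.

Lemma ptrB_red_AB rho t : ptrB (red_AB rho t) = red_A rho.
Proof.
apply/funext => a; apply/funext => a'; rewrite /ptrB /red_A /red_AB /=.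
rewrite [RHS](partition_big (fun g : Bsys n B => g t) predT)//=.
apply: eq_bigr => b _; apply: eq_bigr => g /eqP <-.
by rewrite q_upd_id.
Qed.

Lemma q_trace_red_A rho : q_trace (red_A rho) = q_trace rho.
Proof. by rewrite /q_trace /red_A sum_pair. Qed.

Lemma q_trace_ptrB (Y : finType) (X : q_op R ('I_d * Y)%type) :
  q_trace (ptrB X) = q_trace X.
Proof. by rewrite /q_trace sum_pair. Qed.

Lemma q_trace_red_AB rho t : q_trace (red_AB rho t) = q_trace rho.
Proof. by rewrite -q_trace_ptrB ptrB_red_AB q_trace_red_A. Qed.

Lemma red_AB_psd rho t : q_psd rho -> B t -> q_psd (red_AB rho t).
Proof.
move=> /q_psd_gram[V ->] b0.
suff -> : red_AB (q_gram V) t = q_gram (fun p (ri : Bsys n B * Jsys d n B) =>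
    (ri.1 t == b0)%:R * V (p.1, q_upd ri.1 t p.2) ri.2) by exact: q_gram_psd.
apply/funext => p; apply/funext => q; rewrite (red_AB_slice _ b0) [RHS]sum_pair.
rewrite big_mkcond; apply: eq_bigr => r _ /=; case: eqP => _; last first.
  by rewrite big1// => i _; rewrite !mul0r.
by apply: eq_bigr => i _; rewrite !mul1r.
Qed.

Lemma red_A_psd rho : q_psd rho -> q_psd (red_A rho).
Proof.
move=> /q_psd_gram[V ->].
suff -> : red_A (q_gram V) = q_gram (fun a (ri : Bsys n B * Jsys d n B) =>
    V (a, ri.1) ri.2) by exact: q_gram_psd.
by apply/funext => p; apply/funext => q; rewrite /q_gram [RHS]sum_pair.
Qed.

Section Purification.
Variables (V : Jsys d n B -> Jsys d n B -> C) (s t : 'I_n) (st : s != t).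
Variables (b0 : B s) (c0 : B t).

(* The environment of A B_s B_t: the remaining memories, encoded as the r in
   [Bsys n B] with r s = b0 and r t = c0, together with the purifying system. *)
Definition purif (p : 'I_d * B s) (q : B t * (Bsys n B * Jsys d n B)) : C :=
  ((q.2.1 s == b0) && (q.2.1 t == c0))%:R *
  V (p.1, q_upd (q_upd q.2.1 s p.2) t q.1) q.2.2.

Lemma purif_sum p q (c c' : B t) :
  \sum_e purif p (c, e) * (purif q (c', e))^* =
  \sum_(r : Bsys n B | (r s == b0) && (r t == c0))
    q_gram V (p.1, q_upd (q_upd r s p.2) t c) (q.1, q_upd (q_upd r s q.2) t c').
Proof.
rewrite sum_pair [RHS]big_mkcond; apply: eq_bigr => r _ /=.
rewrite /purif /=; case: ifP => _; last first.
  by rewrite big1// => i _; rewrite !mul0r.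
by apply: eq_bigr => i _; rewrite !mul1r.
Qed.

Lemma purif_AB : red_AB (q_gram V) s = q_gram purif.
Proof.
apply/funext => p; apply/funext => q; rewrite (red_AB_slice _ b0).
rewrite (@sum_slices t c0 (fun r => r s == b0)); last first.
  by move=> g b; rewrite q_upd_other.
rewrite [RHS]sum_pair; apply: eq_bigr => c _; rewrite purif_sum.
by apply: eq_bigr => r _; rewrite !(q_upd_comm _ _ _ st).
Qed.

Lemma purif_AC : red_AB (q_gram V) t = pure_AC purif.
Proof.
apply/funext => p; apply/funext => q; rewrite (red_AB_slice _ c0).
rewrite (@sum_slices s b0 (fun r => r t == c0)); last first.
  by move=> g b; rewrite q_upd_other// eq_sym.
apply: eq_bigr => b _; rewrite purif_sum.
by apply: eq_bigl => r; rewrite andbC.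
Qed.

End Purification.

Lemma red_uncertainty_tripartite rho s t (x z : 'I_d -> 'I_d -> C) (c : R) :
  s != t -> q_density rho -> B s -> B t ->
  q_orthonormal x -> q_orthonormal z -> 0 < c ->
  (forall l k, q_normsq (q_inner (x l) (z k)) <= c) ->
  - log2 c <= condS_MB rho x s + condS_MB rho z t.
Proof.
move=> st [/q_psd_gram[V ->] tr1] b0 c0 hx hz cgt0 hc.
rewrite /condS_MB /red_B (purif_AB V st b0 c0) (purif_AC V st b0 c0).
apply: uncertainty_tripartite => //.
by rewrite -(purif_AB V st b0 c0) q_trace_red_AB.
Qed.

Lemma red_uncertainty_memory rho t (x z : 'I_d -> 'I_d -> C) (c : R) :
  q_density rho -> B t ->
  q_orthonormal x -> q_orthonormal z -> 0 < c ->
  (forall l k, q_normsq (q_inner (x l) (z k)) <= c) ->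
  - log2 c + condS_AB rho t <= condS_MB rho x t + condS_MB rho z t.
Proof.
move=> [psd tr1] b0 hx hz c0 hc.
have aux (u a b e f : R) : u <= a - b + (e - f) ->
  u + (b - f) <= (e - f) + (a - f) by lra.
apply: aux; apply: uncertainty_with_memory => //; first exact: red_AB_psd.
by rewrite q_trace_red_AB.
Qed.

End Slices.

(** * Trivial memory and the bound for the marginal on A *)

Section TrivialMemory.
Context {R : realType}.
Local Notation C := R[i].
Variable (d : nat).

Definition q_triv (X : q_op R 'I_d) : q_op R ('I_d * unit)%type :=
  fun p q => X p.1 q.1.

Lemma sum_unit (V : nmodType) (F : unit -> V) : \sum_u F u = F tt.
Proof. by rewrite (bigD1 tt)//= big1 ?addr0// => -[]. Qed.

Lemma q_triv_psd X : q_psd X -> q_psd (q_triv X).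
Proof.
move=> psd v; have := psd (fun a => v (a, tt)).
congr (_ <= _); rewrite sum_pair; apply: eq_bigr => a _.
by rewrite sum_unit sum_pair; apply: eq_bigr => a' _; rewrite sum_unit.
Qed.

Lemma q_trace_triv X : q_trace (q_triv X) = q_trace X.
Proof.
by rewrite /q_trace sum_pair; apply: eq_bigr => a _; rewrite sum_unit.
Qed.

Lemma q_entropy_triv X : q_psd (q_triv X) -> q_entropy (q_triv X) = q_entropy X.
Proof.
move=> /q_psd_eig[E XE].
have onb : q_onb (fun i a => evec E (i, tt) (a, tt)).
  move=> i j; have := evec_onb E (i, tt) (j, tt); rewrite xpair_eqE andbT => <-.
  by rewrite /q_inner sum_pair; apply: eq_bigr => a _; rewrite sum_unit.
pose E' := QEigSys (fun i => ev_ge0 E (i, tt)) onb.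
have XE' : X = q_ofeig E'.
  apply/funext => a; apply/funext => a'; rewrite -[LHS]/(q_triv X (a, tt) (a', tt)).
  by rewrite XE /q_ofeig sum_pair; apply: eq_bigr => i _; rewrite sum_unit.
rewrite XE [in RHS]XE' !q_entropy_ofeig; congr (- _).
rewrite sum_pair /=.
by apply: eq_bigr => i _; rewrite sum_unit.
Qed.

Lemma q_ofeig_psd (T : finType) (E : q_eigsys R T) : q_psd (q_ofeig E).
Proof.
move=> v; rewrite -/(q_form _ v v) q_form_ofeig ler0c; apply: sumr_ge0 => i _.
by rewrite mulr_ge0 ?ev_ge0 ?q_normsq_ge0.
Qed.

Lemma q_meas_psd (Y : finType) (psi : 'I_d -> 'I_d -> C)
    (X : q_op R ('I_d * Y)%type) :
  q_psd X -> q_orthonormal psi -> q_psd (q_meas psi X).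
Proof.
move=> psd hpsi.
have [E XE] := choice (fun k => q_psd_eig (q_blk_psd (psi k) psd)).
by rewrite (q_meas_eig hpsi XE); exact: q_ofeig_psd.
Qed.

Lemma q_meas_triv (Y : finType) (psi : 'I_d -> 'I_d -> C)
    (X : q_op R ('I_d * Y)%type) :
  q_meas psi (q_triv (ptrB X)) = q_triv (ptrB (q_meas psi X)).
Proof.
apply/funext => p; apply/funext => q; rewrite /q_triv /ptrB /q_meas /=.
rewrite [RHS]exchange_big; apply: eq_bigr => k _ /=.
rewrite [RHS]exchange_big; apply: eq_bigr => a _ /=.
rewrite [RHS]exchange_big; apply: eq_bigr => a' _ /=.
by rewrite mulr_sumr mulr_suml.
Qed.

Lemma q_entropy_unit (X : q_op R unit) : q_density X -> q_entropy X = 0.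
Proof.
move=> [/q_psd_eig[E ->]]; rewrite q_trace_ofeig -(rmorph1 (real_complex R)).
move=> /(@complexI R); rewrite sum_unit q_entropy_ofeig sum_unit => ->.
by rewrite xlog2xE ln1 mulr0 mul0r oppr0.
Qed.

(** A trivial memory has a one-by-one density matrix, of entropy 0, and discarding Y commutes with
    measuring A; the bound with memory then concerns the outcome entropies alone. *)
Lemma uncertainty_marginal (Y : finType) (X : q_op R ('I_d * Y)%type) x z c :
  q_psd (ptrB X) -> q_trace X = 1 -> q_orthonormal x -> q_orthonormal z ->
  0 < c -> (forall l k, q_normsq (q_inner (x l) (z k)) <= c) ->
  - log2 c + q_entropy (ptrB X) <=
    q_entropy (ptrB (q_meas x X)) + q_entropy (ptrB (q_meas z X)).
Proof.
have aux (u a b e : R) : u <= a - b + (e - 0) -> u + b <= e + a by lra.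
move=> psd tr1 hx hz c0 hc.
have psd' := q_triv_psd psd.
have tr1' : q_trace (q_triv (ptrB X)) = 1 by rewrite q_trace_triv q_trace_ptrB.
have measE psi : q_orthonormal psi ->
    q_entropy (q_meas psi (q_triv (ptrB X))) = q_entropy (ptrB (q_meas psi X)).
  move=> hpsi; have := q_meas_psd psd' hpsi.
  by rewrite q_meas_triv => /q_entropy_triv.
have S0 : q_entropy (ptrA (q_triv (ptrB X))) = 0.
  apply: q_entropy_unit; split; last by rewrite q_trace_ptrA.
  by rewrite -(sum_q_blk _ hx); apply: q_psd_sum => k; exact: q_blk_psd.
apply: aux; rewrite -(measE x hx) -(measE z hz) -(q_entropy_triv psd') -S0.
exact: uncertainty_with_memory.
Qed.

End TrivialMemory.

(** * Overlap constants and their logarithms *)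

Section Overlaps.
Context {R : realType}.
Local Notation C := R[i].
Variables (m d : nat) (psi : 'I_m -> 'I_d -> 'I_d -> C).

Lemma le_cij i j k l : q_normsq (q_inner (psi i k) (psi j l)) <= cij psi i j.
Proof.
rewrite /cij; apply: le_trans (le_bigmax _ _ k).
exact: (le_bigmax _ (fun l => q_normsq (q_inner (psi i k) (psi j l))) l).
Qed.

(** Otherwise a vector of basis j would be orthogonal to all of basis i, hence zero, against its
    norm 1. *)
Lemma cij_gt0 i j : 'I_d -> (forall i, q_orthonormal (psi i)) -> 0 < cij psi i j.
Proof.
move=> k hpsi; rewrite ltNge; apply/negP => c0.
have inner0 l : q_inner (psi i l) (psi j k) = 0.
  have := le_trans (le_cij i j l k) c0; case: (q_inner _ _) => a b /=.
  rewrite /q_normsq /= => ab.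
  have a0 : a ^+ 2 = 0 by apply/eqP; rewrite eq_le sqr_ge0 andbT (le_trans _ ab)// lerDl sqr_ge0.
  have b0 : b ^+ 2 = 0 by apply/eqP; rewrite eq_le sqr_ge0 andbT (le_trans _ ab)// lerDr sqr_ge0.
  by apply/eqP; rewrite eq_complex /= -(sqrf_eq0 a) -(sqrf_eq0 b) a0 b0 !eqxx.
have psi0 x : psi j k x = 0.
  rewrite (q_onb_expand (psi j k) x (hpsi i)) big1// => l _.
  by rewrite inner0 mulr0.
have := hpsi j k k; rewrite eqxx /q_inner big1 => [/eqP|x _].
  by rewrite eq_sym oner_eq0.
by rewrite psi0 mulr0.
Qed.

Lemma log2_prod (I : Type) (r : seq I) (P : pred I) (F : I -> R) :
  (forall i, P i -> 0 < F i) ->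
  log2 (\prod_(i <- r | P i) F i) = \sum_(i <- r | P i) log2 (F i).
Proof.
move=> F0; suff [] : 0 < \prod_(i <- r | P i) F i /\
  log2 (\prod_(i <- r | P i) F i) = \sum_(i <- r | P i) log2 (F i) by [].
elim/big_rec2: _ => [|i y x Pi [x0 <-]]; first by rewrite /log2 ln1 mul0r.
by rewrite mulr_gt0 ?F0// /log2 lnM ?posrE ?F0// mulrDl.
Qed.

End Overlaps.

(** * Counting pairs of measurements *)

Section PairSums.
Context {R : realType} {m n : nat}.

Lemma sum_neq_pairs (G : 'I_m -> 'I_m -> R) :
  \sum_i \sum_(j | j != i) G i j = \sum_(i < m) \sum_(j < m | (i < j)%N) (G i j + G j i).
Proof.
under [RHS]eq_bigr => i _ do rewrite big_split /=.
rewrite [RHS]big_split /=.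
rewrite [X in _ = _ + X](exchange_big_dep predT)//= -big_split /=.
apply: eq_bigr => i _; rewrite (bigID (fun j : 'I_m => (i < j)%N)) /=; congr (_ + _).
  by apply: eq_bigl => j; rewrite -val_eqE /=; case: ltngtP.
by apply: eq_bigl => j; rewrite -val_eqE /=; case: ltngtP.
Qed.

Lemma sum_pairs_add (F : 'I_m -> R) :
  \sum_(i < m) \sum_(j < m | (i < j)%N) (F i + F j) = (m%:R - 1) * \sum_i F i.
Proof.
rewrite -(sum_neq_pairs (fun i _ => F i)) mulr_sumr; apply: eq_bigr => i _.
rewrite sumr_const mulrC -[LHS]mulr_natr; congr (_ * _).
have := cardC1 i; rewrite card_ord => ->.
by case: m i => [[]//|k] _; rewrite /= -addn1 natrD addrK.
Qed.

Lemma sum_pairs_const (a : R) :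
  \sum_(i < m) \sum_(j < m | (i < j)%N) a = (m%:R * (m%:R - 1)) / 2 * a.
Proof.
have := sum_pairs_add (fun _ => a / 2).
under eq_bigr => i _ do under eq_bigr => j _ do rewrite -splitr.
by move=> ->; rewrite sumr_const card_ord -[(a / 2) *+ m]mulr_natr; field.
Qed.

(** Ordered pairs with weight f / 2 can be grouped by the class of the first index; a class of size
    N offers N choices of i and N - 1 of j. *)
Lemma sum_pairs_class (tau : 'I_m -> 'I_n) (f : 'I_n -> R) :
  \sum_(i < m) \sum_(j < m | (i < j)%N) (tau i == tau j)%:R * f (tau i) =
  \sum_t (#|[set i | tau i == t]|%:R * (#|[set i | tau i == t]|%:R - 1)) / 2 * f t.
Proof.
pose G i j := (tau i == tau j)%:R * (f (tau i) / 2).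
transitivity (\sum_i \sum_(j | j != i) G i j).
  rewrite sum_neq_pairs; apply: eq_bigr => i _; apply: eq_bigr => j _.
  rewrite /G [tau j == _]eq_sym; case: eqP => [->|_]; last by rewrite !mul0r addr0.
  by rewrite !mul1r -splitr.
rewrite (partition_big tau predT)//=; apply: eq_bigr => t _.
rewrite (eq_bigr (fun _ => (#|[set i | tau i == t]|%:R - 1) * (f t / 2))); last first.
  move=> i /eqP it; rewrite /G -mulr_suml it; congr (_ * _).
  have -> : #|[set i | tau i == t]|%:R = \sum_(j < m) (t == tau j)%:R :> R.
    rewrite -sum1_card natr_sum big_mkcond /=.
    by apply: eq_bigr => j _; rewrite inE eq_sym; case: (t == tau j).
  (* The class size counts i itself; removing that term gives N - 1. *)
  by rewrite [in RHS](bigD1 i)//= it eqxx addrAC subrr add0r.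
rewrite (eq_bigl (fun i => i \in [set i | tau i == t])); last first.
  by move=> i; rewrite inE.
by rewrite sumr_const -[LHS]mulr_natr; field.
Qed.

End PairSums.

(** Here M = m - 1, k = m, N = sum m_t (m_t - 1), L is the sum of the log c_ij, A the weighted sum
    of the S(A|B_t), a = S(A), h the sum of the S(M_i|B_t) and sm that of the S(M_i). When the
    maximum is 0 the first bound divided by M suffices; otherwise A, N and h cancel and the second
    one remains. *)
Lemma combine_bounds (R : realFieldType) (M k N L A a h sm : R) : 0 < M ->
  - L + A <= M * h -> - L + k * M / 2 * a <= M * sm ->
  - (1 / M) * L + 1 / M * A + Num.max 0 ((k * M - N) / (2 * M) * a
    + (N / (2 * M) * a - 1 / M * A) - (sm - h)) <= h.
Proof.
move=> M0 hA ha; have Mn0 : M != 0 by rewrite gt_eqF.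
set D := (X in Num.max 0 X); have [_|_] := leP 0 D; rewrite -subr_ge0 /D.
- rewrite (_ : _ - _ = (M * sm - (- L + k * M / 2 * a)) / M); last by field.
  by rewrite divr_ge0 ?subr_ge0// ltW.
- rewrite (_ : _ - _ = (M * h - (- L + A)) / M); last by field.
  by rewrite divr_ge0 ?subr_ge0// ltW.
Qed.

(** * Summation of the pairwise bounds *)

Theorem theorem1 (R : realType) (m n d : nat) (B : 'I_n -> finType)
  (rho : q_op R (Jsys d n B)) (M : 'I_m -> q_op R 'I_d)
  (psi : 'I_m -> 'I_d -> 'I_d -> R[i]) (S : 'I_n -> {set 'I_m}) :
  (2 <= m)%N -> (1 <= n <= m)%N ->
  q_density rho ->
  (forall i, q_hermitian (M i)) ->
  (forall i, q_orthonormal (psi i)) ->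
  (forall i k, q_eigvec (M i) (psi i k)) ->
  (forall t, S t != set0) ->
  (forall s t, s != t -> [disjoint S s & S t]) ->
  \bigcup_(t : 'I_n) S t = [set: 'I_m] ->
  let mt (t : 'I_n) : R := #|S t|%:R in
  let delta : R :=
    (m%:R * (m%:R - 1) - \sum_(t : 'I_n) mt t * (mt t - 1))
      / (2 * (m%:R - 1)) * q_entropy (red_A rho)
    + \sum_(t : 'I_n) (mt t * (mt t - 1)) / (2 * (m%:R - 1)) * mutinf_AB rho t
    - \sum_(t : 'I_n) \sum_(i in S t) mutinf_MB rho (psi i) t in
  \sum_(t : 'I_n) \sum_(i in S t) condS_MB rho (psi i) t >=
    - (1 / (m%:R - 1)) * log2 (\prod_(i < m) \prod_(j < m | (i < j)%N) cij psi i j)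
    + 1 / (m%:R - 1) * \sum_(t : 'I_n) (mt t * (mt t - 1)) / 2 * condS_AB rho t
    + Num.max 0 delta.
Proof.
move=> m2 _ rhoD _ hpsi _ _ disj cover; cbv beta zeta.
set delta : R := (X in Num.max 0 X).
pose mt (t : 'I_n) : R := #|S t|%:R.
have [psd tr1] := rhoD.
have m1 : 0 < m%:R - 1 :> R by rewrite subr_gt0 ltr1n.
(* Trace 1 forces a nonempty index set: [k0] shows d > 0 and [g0] supplies a reference value in
   every [B t]. *)
have [[k0 g0] _] : exists p : Jsys d n B, True.
  apply: contrapT => no; have := tr1; rewrite /q_trace big1 => [/eqP|p _].
    by rewrite eq_sym oner_eq0.
  by case: no; exists p.
have inS (i : 'I_m) : exists t, i \in S t.
  have : i \in \bigcup_(t : 'I_n) S t by rewrite cover inE.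
  by move=> /bigcupP[t _ it]; exists t.
(* [tau i] is the memory assigned to M_i; by disjointness its fibres are the sets [S t]. *)
have [tau tauS] := choice inS.
have SE t : S t = [set i | tau i == t].
  apply/setP => i; rewrite inE; apply/idP/eqP => [it|<-//].
  apply/eqP; apply: contraT => /disj/pred0P/(_ i) /=.
  by rewrite tauS it.
have sumS (F : 'I_m -> 'I_n -> R) :
    \sum_t \sum_(i in S t) F i t = \sum_i F i (tau i).
  rewrite [RHS](partition_big tau predT)//=; apply: eq_bigr => t _.
  rewrite SE; apply: eq_big => [i|i]; rewrite inE// => /eqP -> //.
have c0 i j : 0 < cij psi i j by exact: cij_gt0.
pose H i := condS_MB rho (psi i) (tau i).
pose SM i := q_entropy (ptrB (q_meas (psi i) (red_AB rho (tau i)))).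
pose SA := q_entropy (red_A rho).
have memory i j : - log2 (cij psi i j) +
    (tau i == tau j)%:R * condS_AB rho (tau i) <= H i + H j.
  rewrite /H; case: eqP => [<-|/eqP tij]; rewrite ?mul1r ?mul0r ?addr0.
    by apply: red_uncertainty_memory => //; [exact: g0|exact: le_cij].
  by apply: red_uncertainty_tripartite => //; [exact: g0|exact: g0|exact: le_cij].
(* S(M_i) is the same whichever memory is traced out, because the measured marginal depends only on
   [red_A]; a pair can thus be treated with one common memory. *)
have SME i t : SM i = q_entropy (ptrB (q_meas (psi i) (red_AB rho t))).
  have E s : q_triv (ptrB (q_meas (psi i) (red_AB rho s))) =
      q_meas (psi i) (q_triv (red_A rho)) by rewrite -q_meas_triv ptrB_red_AB.
  congr q_entropy; apply/funext => a; apply/funext => a'.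
  have := congr1 (fun X => X (a, tt) (a', tt)) (E (tau i)).
  by have := congr1 (fun X => X (a, tt) (a', tt)) (E t); rewrite /= => <-.
have marginal i j : - log2 (cij psi i j) + SA <= SM i + SM j.
  rewrite (SME j (tau i)) /SM /SA -(ptrB_red_AB rho (tau i)).
  apply: uncertainty_marginal => //.
  - by rewrite ptrB_red_AB; exact: red_A_psd.
  - by rewrite q_trace_red_AB.
  - exact: le_cij.
rewrite sumS -/H.
have -> : log2 (\prod_(i < m) \prod_(j < m | (i < j)%N) cij psi i j) =
    \sum_(i < m) \sum_(j < m | (i < j)%N) log2 (cij psi i j).
  rewrite log2_prod => [|i _]; last by rewrite prodr_gt0.
  by apply: eq_bigr => i _; rewrite log2_prod.
set L := \sum_(i < m) _; set A := \sum_t _ * condS_AB rho t.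
have memory_sum : - L + A <= (m%:R - 1) * \sum_i H i.
  rewrite -sum_pairs_add /L /A.
  under [X in _ + X <= _]eq_bigr => t _ do rewrite SE.
  rewrite -(sum_pairs_class tau (condS_AB rho)) -sumrN -big_split /=.
  apply: ler_sum => i _; rewrite -sumrN -big_split /=.
  by apply: ler_sum => j _; exact: memory.
have marginal_sum : - L + m%:R * (m%:R - 1) / 2 * SA <= (m%:R - 1) * \sum_i SM i.
  rewrite -sum_pairs_add /L -sum_pairs_const -sumrN -big_split /=.
  apply: ler_sum => i _; rewrite -sumrN -big_split /=.
  by apply: ler_sum => j _; exact: marginal.
(* I(A:B) = S(A) - S(A|B) splits each term of delta into an entropy of A and a conditional
   entropy. *)
have mutinf_term (k a b e : R) : k / (2 * (m%:R - 1)) * (a + b - e) =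
    k / (2 * (m%:R - 1)) * a - 1 / (m%:R - 1) * (k / 2 * (e - b)).
  by field; rewrite gt_eqF.
pose N := \sum_t mt t * (mt t - 1).
have deltaE : delta = (m%:R * (m%:R - 1) - N) / (2 * (m%:R - 1)) * SA
    + (N / (2 * (m%:R - 1)) * SA - 1 / (m%:R - 1) * A)
    - (\sum_i SM i - \sum_i H i).
  rewrite /delta sumS -/SA -/N; congr (_ + _ - _).
    rewrite mulr_suml mulr_suml mulr_sumr -sumrB; apply: eq_bigr => t _.
    exact: mutinf_term.
  rewrite -sumrB; apply: eq_bigr => i _.
  by rewrite /mutinf_MB /H /condS_MB -/(SM i) opprB addrA.
by rewrite deltaE; apply: combine_bounds.
Qed.
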